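(* Let $(\Phi,\phi)$ be a symmetric couple of types, $F$ an $R$-module of type $\Phi$ with finitely many submodules, $G=\mathrm{Aut}_R(F)$, and $\mathcal H_\phi=\mathrm{End}_G(\mathcal F_\phi)$. For every $\lambda,\mu\le\phi$: (1) $\mathcal H_\phi^{\lambda}$ and $\mathcal H_\phi^{\lambda^-}$ are ideals of $\mathcal H_\phi$. In particular, they contain a unit when considered as rings. (2) $\mathcal H_\phi^{\lambda}\cdot\mathcal H_\phi^{\mu}=\mathcal H_\phi^{\lambda}\cap\mathcal H_\phi^{\mu}$. If the poset $\mathcal T$ of types is a lattice, both are equal to $\mathcal H_\phi^{\lambda\wedge\mu}$. (3) $\{\mathcal K_\lambda=\mathcal H_\phi^{\lambda}/\mathcal H_\phi^{\lambda^-}\}_{\lambda\le\phi}$ is a complete set of inequivalent irreducible $\mathcal H_\phi$-modules. (4) As $\mathcal H_\phi$-modules, $\mathcal H_\phi^{\lambda}\simeq\bigoplus_{\mu\le\lambda}\mathcal K_\mu$.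
   Context: Let $R$ be a ring; modules are finitely generated left $R$-modules. The type $\tau(x)$ of a module $x$ is its isomorphism class, and $\mathcal T$ is the set of types; $\lambda\le\mu$ means that a module of type $\mu$ has a submodule of type $\lambda$. A type $\phi$ is symmetric if for all modules $f,f'$ of type $\phi$, all submodules $x\subseteq f$, $x'\subseteq f'$ and every isomorphism $h:x\to x'$, there is an isomorphism $f\to f'$ extending $h$. For symmetric types $\phi\le\Phi$, $(\Phi,\phi)$ is a symmetric couple if for every module $F$ of type $\Phi$, every $f\subseteq F$ of type $\phi$ and every $\lambda\le\phi$: (i) there is $f'\subseteq F$ with $\tau(f')=\phi$ and $\tau(f\cap f')=\lambda$; (ii) for every $x\subseteq F$ with $\tau(x)\le\phi$, the square formed by $x\cap f$, $x$, $f$, $x+f$ is a pushout, i.e. $x+f\simeq (x\oplus f)/(x\cap f)$ (this holds automatically for modules). For a type $\lambda$, $X_\lambda$ is the set of submodules of $F$ of type $\lambda$, and $\mathcal F_\lambda$ is the space of $\mathbb Q$-valued functions on $X_\lambda$ with $G$-action $[gf](x)=f(g^{-1}x)$. For $\lambda\le\phi$ define $\mathbf T_{\phi\succ\lambda}:\mathcal F_\lambda\to\mathcal F_\phi$ by $(\mathbf T_{\phi\succ\lambda}h)(y)=\sum_{x\in X_\lambda,\,x\subseteq y}h(x)$, $\mathbf T_{\lambda\prec\phi}:\mathcal F_\phi\to\mathcal F_\lambda$ by $(\mathbf T_{\lambda\prec\phi}h)(x)=\sum_{y\in X_\phi,\,y\supseteq x}h(y)$, and $\mathbf c_\lambda=\mathbf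 T_{\phi\succ\lambda}\mathbf T_{\lambda\prec\phi}\in\mathcal H_\phi$. Put $\mathcal H_\phi^{\lambda}=\mathrm{span}_{\mathbb Q}\{\mathbf c_{\lambda'}:\lambda'\le\lambda\}$ and $\mathcal H_\phi^{\lambda^-}=\mathrm{span}_{\mathbb Q}\{\mathbf c_{\lambda'}:\lambda'<\lambda\}$. *)

(* Defs.v *)
From HB Require Import structures.
From mathcomp Require Import all_boot all_order all_algebra.
From mathcomp Require Import boolp classical_sets functions cardinality fsbigop.

Set Implicit Arguments.
Unset Strict Implicit.
Unset Printing Implicit Defensive.

Import GRing.Theory.
Local Open Scope ring_scope.
Local Open Scope quotient_scope.

Record submodule (R : pzRingType) (M : lmodType R) := Submodule {
  submod_pred :> {pred M};
  submod_closedP : GRing.submod_closed submod_pred }.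

HB.instance Definition _ (R : pzRingType) (M : lmodType R) :=
  gen_eqMixin (submodule M).
HB.instance Definition _ (R : pzRingType) (M : lmodType R) :=
  gen_choiceMixin (submodule M).

Lemma submod_subsemi (R : pzRingType) (M : lmodType R) (x : submodule M) :
  GRing.subsemimod_closed (submod_pred x).
Proof.
have [x0 xl] := submod_closedP x.
have xD : {in x &, forall u v, u + v \in x}.
  by move=> u v ux vx; rewrite -[u]scale1r xl.
by split=> [|a u ux]; [split | rewrite -[_ *: _]addr0 xl].
Qed.

HB.instance Definition _ (R : pzRingType) (M : lmodType R) (x : submodule M) :=
  GRing.isSubmodClosed.Build R M (submod_pred x) (submod_subsemi x).

Lemma submodP (R : pzRingType) (M : lmodType R) (x y : submodule M) :
  x =i y -> x = y.
Proof.
case: x y => [p px] [q qx] /= pq.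
have epq : p = q by apply/funext => v; exact: pq.
by case: _ / epq qx {pq} => qx; congr Submodule; exact: Prop_irrelevance.
Qed.

Section Submodules.
Variables (R : pzRingType) (M : lmodType R).
Implicit Types x y : submodule M.

Definition subm x := {v : M | v \in submod_pred x}.
HB.instance Definition _ x := SubChoice.on (subm x).
HB.instance Definition _ x :=
  GRing.SubChoice_isSubLmodule.Build R M (submod_pred x) (subm x)
    (submod_subsemi x).

Fact submod_cap_closed x y : GRing.submod_closed [predI x & y].
Proof.
split=> [|a u v]; first by rewrite inE !rpred0.
by move=> /andP[ux uy] /andP[vx vy]; rewrite inE !rpredD ?rpredZ.
Qed.
Definition submod_cap x y : submodule M := Submodule (submod_cap_closed x y).

Fact submod_add_closed x y : GRing.submod_closed
  [pred w | `[< exists u v : M, [/\ u \in x, v \in y & w = u + v] >]].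
Proof.
split=> [|a w w']; first by apply/asboolP; exists 0, 0; rewrite !rpred0 addr0.
move=> /asboolP[u [v [ux vy ->]]] /asboolP[u' [v' [ux' vy' ->]]].
apply/asboolP; exists (a *: u + u'), (a *: v + v').
by rewrite !rpredD ?rpredZ// scalerDr addrACA.
Qed.
Definition submod_add x y : submodule M := Submodule (submod_add_closed x y).

Fact span_closed (S : set M) : GRing.submod_closed
  [pred v | `[< exists (n : nat) (a : 'I_n -> R) (s : 'I_n -> M),
     (forall i, S (s i)) /\ v = \sum_i a i *: s i >]].
Proof.
split=> [|k v w].
  apply/asboolP; exists 0%N, (fun=> 0), (fun=> 0).
  by split=> [[]//|]; rewrite big_ord0.
move=> /asboolP[n [a [s [sS ->]]]] /asboolP[m [b [t [tS ->]]]].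
apply/asboolP; exists (n + m)%N,
  (fun i : 'I_(n + m) => match fintype.split i with
    inl j => k * a j | inr j => b j end),
  (fun i : 'I_(n + m) => match fintype.split i with
    inl j => s j | inr j => t j end).
split=> [i|]; first by case: fintype.split.
rewrite big_split_ord/= scaler_sumr; congr (_ + _); apply: eq_bigr => i _.
  by rewrite (unsplitK (inl i)) scalerA.
by rewrite (unsplitK (inr i)).
Qed.
Definition span (S : set M) : submodule M := Submodule (span_closed S).

Definition fingen := exists s : seq M, forall v, v \in span [set` s].

Definition submod_incl x y (xy : {subset x <= y}) (u : subm x) : subm y :=
  exist _ (val u) (xy _ (valP u)).
Fact submod_incl_is_linear x y (xy : {subset x <= y}) : linear (submod_incl xy).
Proof. by move=> a u v; apply: val_inj. Qed.
HB.instance Definition _ x y (xy : {subset x <= y}) :=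
  GRing.isLinear.Build R (subm x) (subm y) _ (submod_incl xy) (submod_incl_is_linear xy).

Fact submod_capl x y : {subset submod_cap x y <= x}.
Proof. by move=> v /andP[]. Qed.
Fact submod_capr x y : {subset submod_cap x y <= y}.
Proof. by move=> v /andP[]. Qed.
Fact submod_addl x y : {subset x <= submod_add x y}.
Proof. by move=> v vx; apply/asboolP; exists v, 0; rewrite addr0 rpred0. Qed.
Fact submod_addr x y : {subset y <= submod_add x y}.
Proof. by move=> v vy; apply/asboolP; exists 0, v; rewrite add0r rpred0. Qed.

Definition quotmod x := Quotient.quot (submod_pred x).
HB.instance Definition _ x := GRing.Zmodule.on (quotmod x).

Definition quotmod_scale x (a : R) (q : quotmod x) : quotmod x :=
  \pi_(Quotient.quot (submod_pred x)) (a *: repr q).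

Fact quotmod_scale_pi x a (v : M) :
  quotmod_scale a (\pi_(Quotient.quot (submod_pred x)) v : quotmod x) =
  \pi_(Quotient.quot (submod_pred x)) (a *: v).
Proof.
apply/eqP; rewrite -Quotient.idealrBE -scalerBr rpredZ//.
by rewrite Quotient.idealrBE reprK.
Qed.

Fact quotmod_scaleA x a b (q : quotmod x) :
  quotmod_scale a (quotmod_scale b q) = quotmod_scale (a * b) q.
Proof.
by rewrite [in LHS]/quotmod_scale -/(quotmod_scale _ _) quotmod_scale_pi scalerA.
Qed.
Fact quotmod_scale1 x : left_id 1 (@quotmod_scale x).
Proof. by move=> q; rewrite /quotmod_scale scale1r reprK. Qed.
Fact quotmod_scaleDr x : right_distributive (@quotmod_scale x) +%R.
Proof.
move=> a p q; rewrite -[p]reprK -[q]reprK -raddfD/= !quotmod_scale_pi -raddfD/=.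
by rewrite scalerDr.
Qed.
Fact quotmod_scaleDl x (q : quotmod x) :
  {morph (@quotmod_scale x)^~ q : a b / a + b}.
Proof. by move=> a b; rewrite /quotmod_scale scalerDl raddfD. Qed.

HB.instance Definition _ x := GRing.Zmodule_isLmodule.Build R (quotmod x)
  (@quotmod_scaleA x) (@quotmod_scale1 x) (@quotmod_scaleDr x) (@quotmod_scaleDl x).

End Submodules.

Arguments fingen {R} M.

Section Morphisms.
Variable R : pzRingType.

Definition isomorphic (M N : lmodType R) :=
  exists f : {linear M -> N}, bijective f.

Fact submod_preim_closed (M N : lmodType R) (f : {linear M -> N})
  (y : submodule N) : GRing.submod_closed [pred v | f v \in y].
Proof.
split=> [|a u v]; first by rewrite inE raddf0 rpred0.
by rewrite !inE => uy vy; rewrite linearP rpredD ?rpredZ.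
Qed.
Definition submod_preim (M N : lmodType R) (f : {linear M -> N})
  (y : submodule N) : submodule M := Submodule (submod_preim_closed f y).

Definition is_pushout (A B C D : lmodType R) (i : {linear A -> B})
    (j : {linear A -> C}) (k : {linear B -> D}) (l : {linear C -> D}) :=
  (forall a, k (i a) = l (j a)) /\
  forall (P : lmodType R) (b : {linear B -> P}) (c : {linear C -> P}),
    (forall a, b (i a) = c (j a)) ->
    exists d : {linear D -> P},
      [/\ forall v, d (k v) = b v, forall w, d (l w) = c w
        & forall d' : {linear D -> P}, (forall v, d' (k v) = b v) ->
            (forall w, d' (l w) = c w) -> d' =1 d].

Definition irreducible (M : lmodType R) :=
  (exists v : M, v != 0) /\
  forall x : submodule M, (forall v, v \in x -> v = 0) \/ (forall v, v \in x).

End Morphisms.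

(* Indexed by ['I_n] because a product over isomorphism classes of modules
   would not fit in the universe of [lmodType R]. *)
Section DirectSum.
Variables (R : pzRingType) (n : nat) (K : 'I_n -> lmodType R).

Definition dsum := forall i, K i.
HB.instance Definition _ := Choice.on dsum.
Implicit Types u v w : dsum.

Let addsA : associative (fun u v : dsum => (fun i => u i + v i) : dsum).
Proof. by move=> u v w; apply: functional_extensionality_dep => i; exact: addrA. Qed.
Let addsC : commutative (fun u v : dsum => (fun i => u i + v i) : dsum).
Proof. by move=> u v; apply: functional_extensionality_dep => i; exact: addrC. Qed.
Let add0s : left_id ((fun=> 0) : dsum)
  (fun u v : dsum => (fun i => u i + v i) : dsum).
Proof. by move=> u; apply: functional_extensionality_dep => i; exact: add0r. Qed.
Let addNs : left_inverse ((fun=> 0) : dsum) (fun u : dsum => (fun i => - u i) : dsum)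
  (fun u v : dsum => (fun i => u i + v i) : dsum).
Proof. by move=> u; apply: functional_extensionality_dep => i; exact: addNr. Qed.
HB.instance Definition _ := GRing.isZmodule.Build dsum addsA addsC add0s addNs.

Let scalesA a b u :
  (fun i => a *: (b *: u i)) = (fun i => (a * b) *: u i) :> dsum.
Proof. by apply: functional_extensionality_dep => i; exact: scalerA. Qed.
Let scale1s : left_id 1 (fun a u => (fun i => a *: u i) : dsum).
Proof. by move=> u; apply: functional_extensionality_dep => i; exact: scale1r. Qed.
Let scalesDr : right_distributive (fun a u => (fun i => a *: u i) : dsum) +%R.
Proof.
by move=> a u v; apply: functional_extensionality_dep => i; exact: scalerDr.
Qed.
Let scalesDl u : {morph (fun a => (fun i => a *: u i) : dsum) : a b / a + b}.
Proof.
by move=> a b; apply: functional_extensionality_dep => i; exact: scalerDl.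
Qed.
HB.instance Definition _ := GRing.Zmodule_isLmodule.Build R dsum
  scalesA scale1s scalesDr scalesDl.

End DirectSum.

Section Ideals.
Variable A : pzRingType.

Definition is_ideal (I : {pred A}) := GRing.zmod_closed I /\
  forall a, {in I, forall u, a * u \in I /\ u * a \in I}.

Definition has_unit (I : {pred A}) :=
  exists2 e, e \in I & {in I, forall u, e * u = u /\ u * e = u}.

Definition ideal_mul (I J : {pred A}) : {pred A} :=
  [pred w | `[< exists (n : nat) (u v : 'I_n -> A),
     (forall i, u i \in I /\ v i \in J) /\ w = \sum_i u i * v i >]].

Fact left_ideal_closed (I : {pred A}) : is_ideal I ->
  GRing.submod_closed (I : {pred A^o}).
Proof.
move=> [[I0 IB] IM]; split=> // a u v uI vI.
have NI w : w \in I -> - w \in I by move=> wI; rewrite -sub0r IB.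
by rewrite -[v]opprK IB ?NI//; have [] := IM a u uI.
Qed.
Definition left_ideal (I : {pred A}) (iI : is_ideal I) : submodule A^o :=
  Submodule (left_ideal_closed iI).

Definition ideal_mod (I : {pred A}) (iI : is_ideal I) : lmodType A :=
  subm (left_ideal iI).

(* [I / J] as a left [A]-module; in general [I / (I \cap J)]. *)
Definition ideal_quot (I J : {pred A}) (iI : is_ideal I) (iJ : is_ideal J) :
    lmodType A :=
  quotmod (submod_preim (val : {linear subm (left_ideal iI) -> A^o})
    (left_ideal iJ)).

End Ideals.

Section Types.
Variable R : pzRingType.

(* An isomorphism class of finitely generated modules, as a predicate; [mtypeP]
   is a proposition, so equality of types is equality of classes. *)
Record mtype := MType {
  has_type : lmodType R -> Prop;
  mtypeP : exists2 M, fingen M & forall N, has_type N <-> isomorphic M N }.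

Implicit Types lam mu nu phi : mtype.

Definition mtype_le lam mu :=
  exists2 M, has_type mu M & exists x : submodule M, has_type lam (subm x).

Definition mtype_lt lam mu := mtype_le lam mu /\ lam <> mu.

Definition is_meet lam mu nu := [/\ mtype_le nu lam, mtype_le nu mu &
  forall k, mtype_le k lam -> mtype_le k mu -> mtype_le k nu].

Definition is_join lam mu nu := [/\ mtype_le lam nu, mtype_le mu nu &
  forall k, mtype_le lam k -> mtype_le mu k -> mtype_le nu k].

(* [mtype_le] is reflexive and transitive over every ring. *)
Definition mtypes_lattice :=
  [/\ forall lam mu, mtype_le lam mu -> mtype_le mu lam -> lam = mu,
      forall lam mu, exists nu, is_meet lam mu nu
    & forall lam mu, exists nu, is_join lam mu nu].

Definition mtype_symmetric phi :=
  forall M M' : lmodType R, has_type phi M -> has_type phi M' ->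
  forall (x : submodule M) (x' : submodule M'),
    fingen (subm x) -> fingen (subm x') ->
  forall h : {linear subm x -> subm x'}, bijective h ->
  exists2 g : {linear M -> M'}, bijective g &
    forall u : subm x, g (val u) = val (h u).

Definition symmetric_couple Phi phi :=
  [/\ mtype_symmetric Phi, mtype_symmetric phi, mtype_le phi Phi &
    forall (F : lmodType R) (f : submodule F) lam,
      has_type Phi F -> has_type phi (subm f) -> mtype_le lam phi ->
      (exists f' : submodule F,
        has_type phi (subm f') /\ has_type lam (subm (submod_cap f f'))) /\
      (forall (x : submodule F) mu, has_type mu (subm x) -> mtype_le mu phi ->
        is_pushout (submod_incl (@submod_capl _ _ x f)) (submod_incl (@submod_capr _ _ x f))
                   (submod_incl (@submod_addl _ _ x f)) (submod_incl (@submod_addr _ _ x f)))].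

End Types.

Section Hecke.
Variables (R : pzRingType) (F : lmodType R).
Implicit Types (lam phi : mtype R).

(* [X_lam]; [Fun lam] is the space of functions on it. *)
Definition submods lam : set (submodule F) := [set x | has_type lam (subm x)].
Notation X := submods.
Notation Fun lam := (X lam -> rat^o).

Record aut := Aut { aut_fun :> {linear F -> F}; aut_bij : bijective aut_fun }.

Fact aut_inv_subproof (g : aut) : exists h : aut, cancel g h /\ cancel h g.
Proof.
have [h gh hg] := aut_bij g.
pose hl : {linear F -> F} :=
  HB.pack h (GRing.isLinear.Build R F F _ h (can2_linear gh hg)).
by exists (@Aut hl (Bijective hg gh)).
Qed.

Fact submods_preim_subproof lam (g : aut) (x : X lam) :
  submod_preim g (val x) \in X lam.
Proof.
have xl : has_type lam (subm (val x)) by have := valP x; rewrite inE.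
rewrite inE /submods/=; have [M _ lamE] := mtypeP lam.
have [f [f' ff' f'f]] := (lamE _).1 xl; apply/lamE.
have [h [gh hg]] := aut_inv_subproof g.
have hx (u : M) : h (val (f u)) \in submod_pred (submod_preim g (val x)).
  by rewrite inE/= hg; exact: valP.
pose k (u : M) : subm (submod_preim g (val x)) :=
  exist (fun v => v \in submod_pred _) _ (hx u).
have kl : linear k by move=> a u v; apply: val_inj; rewrite /= !linearP.
pose kL : {linear M -> subm (submod_preim g (val x))} :=
  HB.pack k (GRing.isLinear.Build R M _ _ k kl).
exists kL.
pose k' (w : subm (submod_preim g (val x))) : M :=
  f' (exist (fun v => v \in submod_pred _) (g (val w)) (valP w)).
exists k' => [u|w]/=.
  rewrite /k' -[RHS]ff'; congr f'; apply: val_inj => /=; exact: hg.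
by apply: val_inj => /=; rewrite /k' f'f/= gh.
Qed.

(* [g^-1 x] *)
Definition aut_inv_act lam (g : aut) (x : X lam) : X lam :=
  exist (fun y => y \in submods lam) _ (submods_preim_subproof g x).

Definition aut_act lam (g : aut) (h : Fun lam) : Fun lam :=
  fun x => h (aut_inv_act g x).

(* [End_G (Fun phi)] *)
Record hecke phi := Hecke {
  hecke_fun :> Fun phi -> Fun phi;
  hecke_linear : linear hecke_fun;
  hecke_equivariant : forall g h,
    hecke_fun (aut_act g h) = aut_act g (hecke_fun h) }.

Lemma heckeP phi (S T : hecke phi) : hecke_fun S =1 hecke_fun T -> S = T.
Proof.
case: S T => [s sl sg] [t tl tg] /= st.
have est : s = t by apply/funext.
by case: _ / est tl tg {st} => tl tg; congr Hecke; exact: Prop_irrelevance.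
Qed.

HB.instance Definition _ phi := gen_eqMixin (hecke phi).
HB.instance Definition _ phi := gen_choiceMixin (hecke phi).
HB.instance Definition _ phi (T : hecke phi) :=
  GRing.isLinear.Build rat (Fun phi) (Fun phi) _ (hecke_fun T) (hecke_linear T).

Section HeckeAlgebra.
Variable phi : mtype R.
Implicit Types (S T : hecke phi) (g : aut) (h : Fun phi).

Let zero_linear : linear ((fun=> 0) : Fun phi -> Fun phi).
Proof. by move=> a u v; rewrite scaler0 addr0. Qed.
Let zero_equiv g h : 0 = aut_act g (0 : Fun phi). Proof. by []. Qed.
Definition hecke_zero : hecke phi := Hecke zero_linear zero_equiv.

Let opp_linear T : linear (fun h : Fun phi => - T h).
Proof. by move=> a u v; rewrite linearP opprD scalerN. Qed.
Let opp_equiv T g h : - T (aut_act g h) = aut_act g (- T h).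
Proof. by rewrite hecke_equivariant. Qed.
Definition hecke_opp T : hecke phi := Hecke (opp_linear T) (@opp_equiv T).

Let add_linear S T : linear (fun h : Fun phi => S h + T h).
Proof. by move=> a u v; rewrite !linearP scalerDr addrACA. Qed.
Let add_equiv S T g h :
  S (aut_act g h) + T (aut_act g h) = aut_act g (S h + T h).
Proof. by rewrite !hecke_equivariant. Qed.
Definition hecke_add S T : hecke phi :=
  Hecke (add_linear S T) (@add_equiv S T).

Let one_linear : linear (@id (Fun phi)). Proof. by []. Qed.
Let one_equiv g h : id (aut_act g h) = aut_act g (id h). Proof. by []. Qed.
Definition hecke_one : hecke phi := Hecke one_linear one_equiv.

Let mul_linear S T : linear (fun h : Fun phi => S (T h)).
Proof. by move=> a u v; rewrite !linearP. Qed.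
Let mul_equiv S T g h : S (T (aut_act g h)) = aut_act g (S (T h)).
Proof. by rewrite !hecke_equivariant. Qed.
Definition hecke_mul S T : hecke phi :=
  Hecke (mul_linear S T) (@mul_equiv S T).

Let scale_linear (a : rat) T : linear (fun h : Fun phi => a *: T h).
Proof. by move=> b u v; rewrite linearP scalerDr !scalerA mulrC. Qed.
Let scale_equiv (a : rat) T g h : a *: T (aut_act g h) = aut_act g (a *: T h).
Proof. by rewrite hecke_equivariant. Qed.
Definition hecke_scale (a : rat) T : hecke phi :=
  Hecke (scale_linear a T) (@scale_equiv a T).

Let addTA : associative hecke_add.
Proof. by move=> ? ? ?; apply: heckeP => h; exact: addrA. Qed.
Let addTC : commutative hecke_add.
Proof. by move=> ? ?; apply: heckeP => h; exact: addrC. Qed.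
Let add0T : left_id hecke_zero hecke_add.
Proof. by move=> ?; apply: heckeP => h; exact: add0r. Qed.
Let addNT : left_inverse hecke_zero hecke_opp hecke_add.
Proof. by move=> ?; apply: heckeP => h; exact: addNr. Qed.
HB.instance Definition _ := GRing.isZmodule.Build (hecke phi)
  addTA addTC add0T addNT.

Let mulTA : associative hecke_mul.
Proof. by move=> ? ? ?; apply: heckeP. Qed.
Let mul1T : left_id hecke_one hecke_mul.
Proof. by move=> ?; apply: heckeP. Qed.
Let mulT1 : right_id hecke_one hecke_mul.
Proof. by move=> ?; apply: heckeP. Qed.
Let mulTDl : left_distributive hecke_mul +%R.
Proof. by move=> ? ? ?; apply: heckeP. Qed.
Let mulTDr : right_distributive hecke_mul +%R.
Proof. by move=> S ? ?; apply: heckeP => h; exact: raddfD. Qed.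
HB.instance Definition _ := GRing.Zmodule_isPzRing.Build (hecke phi)
  mulTA mul1T mulT1 mulTDl mulTDr.

Let scaleTA a b T : hecke_scale a (hecke_scale b T) = hecke_scale (a * b) T.
Proof. by apply: heckeP => h; exact: scalerA. Qed.
Let scale1T : left_id 1 hecke_scale.
Proof. by move=> T; apply: heckeP => h; exact: scale1r. Qed.
Let scaleTDr : right_distributive hecke_scale +%R.
Proof. by move=> a S T; apply: heckeP => h; exact: scalerDr. Qed.
Let scaleTDl T : {morph hecke_scale^~ T : a b / a + b}.
Proof. by move=> a b; apply: heckeP => h; exact: scalerDl. Qed.
HB.instance Definition _ := GRing.Zmodule_isLmodule.Build rat (hecke phi)
  scaleTA scale1T scaleTDr scaleTDl.

End HeckeAlgebra.

(* [T_up phi] and [T_down lam] sum over the submodules contained in, resp.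
   containing, a given one; [\sum_(_ \in _)] is 0 on infinite supports, hence
   the finiteness hypothesis [finF] below. *)
Definition T_up lam phi (h : Fun lam) : Fun phi :=
  fun y => \sum_(x \in [set x : X lam | {subset val x <= val y}]) h x.

Definition T_down lam phi (h : Fun phi) : Fun lam :=
  fun x => \sum_(y \in [set y : X phi | {subset val x <= val y}]) h y.

Arguments T_up {lam} phi h _.
Arguments T_down lam {phi} h _.

Hypothesis finF : finite_set [set: submodule F].

Let finX lam (A : set (X lam)) : finite_set A.
Proof.
suff: finite_set [set: X lam] by apply: sub_finite_set => ? _.
have fX : finite_set (val @` [set: X lam]).
  by apply: sub_finite_set finF.
rewrite -(eq_finite_set (inj_card_eq (f := val) _))// => ? ? _ _;
exact: val_inj.
Qed.

Let fsum_linear lam (A : set (X lam)) (a : rat) (u v : Fun lam) :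
  \sum_(x \in A) (a *: u + v) x =
  a *: (\sum_(x \in A) u x : rat^o) + \sum_(x \in A) v x.
Proof.
have fA := finX A; rewrite !fsbig_finite//.
by elim/big_ind3 : _ => [|p q r p' q' r' -> ->|//]; rewrite ?scaler0 ?addr0//
  scalerDr addrACA.
Qed.

Let T_up_linear lam phi : linear (@T_up lam phi).
Proof. by move=> a u v; apply/funext => y; exact: fsum_linear. Qed.
Let T_down_linear lam phi : linear (@T_down lam phi).
Proof. by move=> a u v; apply/funext => y; exact: fsum_linear. Qed.

Let aut_inv_act_surj lam g (x : X lam) : exists x' : X lam,
  aut_inv_act g x' = x.
Proof.
have [h [gh hg]] := aut_inv_subproof g; exists (aut_inv_act h x).
by apply: val_inj; apply: submodP => v; rewrite !inE/= gh.
Qed.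

Let aut_inv_act_inj lam g : injective (@aut_inv_act lam g).
Proof.
move=> x y /(congr1 val)/= exy; have [h [gh hg]] := aut_inv_subproof g.
apply: val_inj; apply: submodP => v.
have /(congr1 (fun z : submodule F => h v \in z)) := exy.
by rewrite !inE/= hg.
Qed.

Let aut_inv_act_sub lam mu g (x : X lam) (y : X mu) :
  {subset val (aut_inv_act g x) <= val (aut_inv_act g y)} <->
  {subset val x <= val y}.
Proof.
have [h [gh hg]] := aut_inv_subproof g.
split=> xy v; last by rewrite !inE/=; exact: xy.
by have := xy (h v); rewrite !inE/= hg.
Qed.

Let T_up_equiv lam phi g (h : Fun lam) :
  T_up phi (aut_act g h) = aut_act g (T_up phi h).
Proof.
apply/funext => y; rewrite /aut_act /T_up.
apply/esym/(reindex_fsbig (@aut_inv_act lam g)); split.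
- by move=> x xy; apply/aut_inv_act_sub.
- by move=> ? ? _ _; exact: aut_inv_act_inj.
- move=> x xy; have [x' x'E] := aut_inv_act_surj g x.
  by exists x' => //; apply/(aut_inv_act_sub g); rewrite x'E.
Qed.

Let T_down_equiv lam phi g (h : Fun phi) :
  T_down lam (aut_act g h) = aut_act g (T_down lam h).
Proof.
apply/funext => x; rewrite /aut_act /T_down.
apply/esym/(reindex_fsbig (@aut_inv_act phi g)); split.
- by move=> y xy; apply/aut_inv_act_sub.
- by move=> ? ? _ _; exact: aut_inv_act_inj.
- move=> y xy; have [y' y'E] := aut_inv_act_surj g y.
  by exists y' => //; apply/(aut_inv_act_sub g); rewrite y'E.
Qed.

Fact cellop_linear lam phi : linear (T_up phi \o @T_down lam phi).
Proof. by move=> a u v; rewrite /= T_down_linear T_up_linear. Qed.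
Fact cellop_equivariant lam phi g (h : Fun phi) :
  T_up phi (T_down lam (aut_act g h)) = aut_act g (T_up phi (T_down lam h)).
Proof. by rewrite T_down_equiv T_up_equiv. Qed.

(* [c_lam] *)
Definition cellop phi lam : hecke phi :=
  Hecke (@cellop_linear lam phi) (@cellop_equivariant lam phi).

(* The spanning sets are bare predicates: [mtype R] is too large for the set
   comprehension notation. *)
Definition hecke_le phi lam : submodule (hecke phi) :=
  span (fun T => exists2 mu, mtype_le mu lam & T = cellop phi mu).

Definition hecke_lt phi lam : submodule (hecke phi) :=
  span (fun T => exists2 mu, mtype_lt mu lam & T = cellop phi mu).

End Hecke.

(* Main.v *)
Require Import Defs.
From HB Require Import structures.
From mathcomp Require Import finmap.
From mathcomp Require Import all_boot all_order all_algebra.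
From mathcomp Require Import boolp classical_sets functions cardinality fsbigop.
Local Open Scope ring_scope.

(** The algebra [H] of [G]-equivariant endomorphisms of the space of functions
    on [X = X_phi] is commutative and split semisimple over [rat], and the
    operators [c_lam] are triangular with respect to its primitive idempotents.

    Write an element of [H] as a matrix indexed by [X * X].  Two pairs of
    submodules of type [phi] are conjugate under [G] exactly when their
    intersections have the same type ([pair_conj]): an isomorphism of the
    intersections extends to the first members by symmetry of [phi], glues with
    an extension to the second members along the pushout, and the result extends
    to [F] by symmetry of [Phi].  Hence the entry at [(y, y')] depends only on the
    type of [y \cap y'].  Such matrices are symmetric, so [H] is commutative
    ([hecke_mulC]), and [T * T = 0] forces the sum of the squares of the entries
    in each row to vanish, so [H] has no nilpotents ([hecke_reduced]).

    The entry of [c_lam] at [(y, y')] is the number of submodules of type [lam]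
    of [y \cap y'].  Moebius inversion over the poset of submodules therefore
    writes every element of [H] uniquely as a combination of the [c_lam]
    ([cellop_coords], [cellop_free]); uniqueness uses that every submodule of [y]
    is of the form [y \cap y'] ([cap_surj]).

    The key point is that [c_lam * T] only involves the [c_mu] with [mu <= lam]
    ([cellop_mul]).  Its entry at [(y, y')] is the sum, over the [x] of type
    [lam] inside [y], of the sum of the entries of [T] at [(z, y')] for [z]
    containing [x].  The latter depends only on [x \cap y'] when [x] is fixed,
    because an automorphism fixing [x] identifies any two [y'] with the same
    [x \cap y'] ([stab_conj]).  Moebius inversion inside each [x] then produces
    only submodules [u] of some [x] of type [lam].

    The rest is algebra.  In a commutative algebra without nilpotents, with a
    basis [c_i] indexed by a finite poset such that every down-closed set of
    indices spans an ideal, each of these ideals has a unit ([unit_ex]).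
    Differences of such units are orthogonal idempotents [e_i] of sum [1] with
    [T * e_i] a rational multiple of [e_i], and the ideal of a down-closed set
    [D] consists of the [T] with [T * e_i = 0] for [i] outside [D]
    ([idempotents_ex]).  From this description, ideals, units, products and
    intersections are immediate, and [K_lam] is the line spanned by the
    idempotent of index [lam]. *)

Set Implicit Arguments.
Unset Strict Implicit.
Unset Printing Implicit Defensive.
Import GRing.Theory.
(* The vector space library also has a [span]. *)
Local Notation span := Defs.span.

(** * Modules, isomorphisms and types *)

Section Isomorphisms.
Variable R : pzRingType.
Implicit Types M N P : lmodType R.

(** A linear map from a function and a proof that it is linear. *)
Definition mk_linear M N (f : M -> N) (fl : linear f) : {linear M -> N} :=
  HB.pack f (GRing.isLinear.Build R M N _ f fl).

Lemma linear_inverse M N (f : {linear M -> N}) :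
  bijective f -> exists g : {linear N -> M}, cancel f g /\ cancel g f.
Proof.
case=> g fg gf.
by exists (mk_linear (can2_linear fg gf)).
Qed.

Lemma isomorphic_refl M : isomorphic M M.
Proof. by exists idfun; exists idfun. Qed.

Lemma isomorphic_sym M N : isomorphic M N -> isomorphic N M.
Proof.
move=> [f /linear_inverse[g [fg gf]]]; exists g.
by exists f.
Qed.

Lemma isomorphic_trans M N P :
  isomorphic M N -> isomorphic N P -> isomorphic M P.
Proof.
move=> [f bf] [g bg]; exists (g \o f).
exact: bij_comp.
Qed.

Lemma in_span M (A : set M) v :
  reflect (exists (n : nat) (a : 'I_n -> R) (s : 'I_n -> M),
     (forall i, A (s i)) /\ v = \sum_i a i *: s i) (v \in span A).
Proof. exact: asboolP. Qed.

Lemma span_subset M (A : set M) v : A v -> v \in span A.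
Proof.
move=> Av; apply/in_span; exists 1%N, (fun=> 1), (fun=> v).
by split=> //; rewrite big_ord1 scale1r.
Qed.

Lemma span_min M (A : set M) (x : submodule M) :
  (forall v, A v -> v \in x) -> {subset span A <= x}.
Proof.
move=> Ax v /in_span[n [a [s [sA ->]]]].
by apply: rpred_sum => i _; apply: rpredZ; apply: Ax.
Qed.

Lemma isomorphic_fingen M N : isomorphic M N -> fingen M -> fingen N.
Proof.
move=> [f /linear_inverse[g [fg gf]]] [s sM]; exists (map f s) => v.
have /in_span[n [a [t [tS gv]]]] := sM (g v).
apply/in_span; exists n, a, (f \o t); split.
  by move=> i; apply: map_f; exact: tS.
by rewrite -[LHS]gf gv linear_sum; apply: eq_bigr => i _; rewrite linearZ_LR.
Qed.

Lemma has_type_iso (lam : mtype R) M N :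
  has_type lam M -> isomorphic M N -> has_type lam N.
Proof.
have [L _ E] := mtypeP lam => /E LM MN; apply/E; exact: isomorphic_trans MN.
Qed.

Lemma has_type_isomorphic (lam : mtype R) M N :
  has_type lam M -> has_type lam N -> isomorphic M N.
Proof.
have [L _ E] := mtypeP lam => /E LM /E LN.
exact: isomorphic_trans (isomorphic_sym LM) LN.
Qed.

Lemma has_type_ex (lam : mtype R) : exists M, has_type lam M.
Proof. by have [L _ E] := mtypeP lam; exists L; apply/E/isomorphic_refl. Qed.

(** Two types with a common module are equal. *)
Lemma mtype_eq (lam mu : mtype R) M :
  has_type lam M -> has_type mu M -> lam = mu.
Proof.
move=> lM mM.
have E : has_type lam = has_type mu.
  apply/funext => N; apply/propext; split=> [lN|mN].
    exact: has_type_iso mM (has_type_isomorphic lM lN).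
  exact: has_type_iso lM (has_type_isomorphic mM mN).
case: lam mu E {lM mM} => [p pP] [q qP] /= E; case: _ / E qP => qP.
congr MType; exact: Prop_irrelevance.
Qed.

(** The isomorphism class of a finitely generated module. *)
Definition mtype_of M (fM : fingen M) : mtype R :=
  MType (ex_intro2 _ (fun L => forall N, isomorphic M N <-> isomorphic L N)
           M fM (fun=> iff_refl _)).

Lemma mtype_ofP M (fM : fingen M) : has_type (mtype_of fM) M.
Proof. exact: isomorphic_refl. Qed.

Lemma in_submod_cap M (x y : submodule M) v :
  (v \in submod_cap x y) = (v \in x) && (v \in y).
Proof. by []. Qed.

Lemma subm_mem M (x : submodule M) (v : subm x) : val v \in x.
Proof. exact: valP. Qed.

(** The intersection of [u] with [x], as a submodule of the module [subm x]. *)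
Definition submod_in M (x u : submodule M) : submodule (subm x) :=
  submod_preim (val : {linear subm x -> M}) u.

Lemma submod_in_iso M (x u : submodule M) :
  {subset u <= x} -> isomorphic (subm u) (subm (submod_in x u)).
Proof.
move=> ux.
pose f (v : subm u) : subm (submod_in x u) :=
  exist (fun w => w \in submod_pred (submod_in x u)) (submod_incl ux v) (valP v).
have fl : linear f by move=> a v w; do 2!apply: val_inj.
exists (mk_linear fl).
exists (fun w => exist (fun v => v \in submod_pred u) (val (val w)) (valP w)).
  by move=> v; apply: val_inj.
by move=> w; do 2!apply: val_inj.
Qed.

Fact submod_out_closed M (x : submodule M) (u : submodule (subm x)) :
  GRing.submod_closed [pred v | `[< exists2 w, w \in u & val w = v >]].
Proof.
split=> [|a v v']; first by apply/asboolP; exists 0; rewrite ?rpred0.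
move=> /asboolP[w wu <-] /asboolP[w' wu' <-]; apply/asboolP.
by exists (a *: w + w'); rewrite ?rpredD ?rpredZ.
Qed.
(** The submodule of [M] formed by the elements of a submodule of [subm x]. *)
Definition submod_out M (x : submodule M) (u : submodule (subm x)) :
  submodule M := Submodule (submod_out_closed u).

Lemma submod_outK M (x : submodule M) (u : submodule (subm x)) :
  submod_in x (submod_out u) = u.
Proof.
apply: submodP => v; apply/idP/idP => [/asboolP[w wu /val_inj <-]//|vu].
by apply/asboolP; exists v.
Qed.

Lemma submod_out_sub M (x : submodule M) (u : submodule (subm x)) :
  {subset submod_out u <= x}.
Proof. by move=> v /asboolP[w _ <-]; exact: valP. Qed.

Lemma mtype_le_sub M (x u : submodule M) (lam mu : mtype R) :
  has_type lam (subm u) -> has_type mu (subm x) -> {subset u <= x} ->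
  mtype_le lam mu.
Proof.
move=> lu mx ux; exists (subm x) => //; exists (submod_in x u).
exact: has_type_iso lu (submod_in_iso ux).
Qed.

Lemma submod_preim_bij_iso M N (f : {linear M -> N}) (y : submodule N) :
  bijective f -> isomorphic (subm y) (subm (submod_preim f y)).
Proof.
move=> /linear_inverse[g [fg gf]].
have gy (u : subm y) : g (val u) \in submod_pred (submod_preim f y).
  by rewrite inE/= gf; exact: valP.
pose k (u : subm y) : subm (submod_preim f y) :=
  exist (fun v => v \in submod_pred _) _ (gy u).
have kl : linear k by move=> a u v; apply: val_inj; rewrite /= linearP.
exists (mk_linear kl).
exists (fun w => exist (fun v => v \in submod_pred y) (f (val w)) (valP w)).
  by move=> u; apply: val_inj => /=; rewrite gf.
by move=> u; apply: val_inj => /=; rewrite fg.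
Qed.

(** If [lam <= mu], every submodule of type [mu] contains one of type [lam]. *)
Lemma mtype_le_ex M (x : submodule M) (lam mu : mtype R) :
  mtype_le lam mu -> has_type mu (subm x) ->
  exists2 u : submodule M, {subset u <= x} & has_type lam (subm u).
Proof.
move=> [N mN [v lv]] mx.
have [f /[dup] bf /linear_inverse[g [fg gf]]] := has_type_isomorphic mx mN.
exists (submod_out (submod_preim f v)); first exact: submod_out_sub.
apply: has_type_iso lv _; apply: isomorphic_trans (submod_preim_bij_iso v bf) _.
apply: isomorphic_sym; apply: isomorphic_trans (submod_in_iso _) _.
  exact: submod_out_sub.
rewrite submod_outK; exact: isomorphic_refl.
Qed.

Lemma mtype_le_refl (lam : mtype R) : mtype_le lam lam.
Proof.
have [M lM] := has_type_ex lam; exists M => //.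
have tM : GRing.submod_closed (predT : {pred M}) by split.
exists (Submodule tM); apply: has_type_iso lM _.
pose f (v : M) : subm (Submodule tM) :=
  exist (fun w => w \in submod_pred (Submodule tM)) v isT.
have fl : linear f by move=> a v w; apply: val_inj.
exists (mk_linear fl).
by exists val => // v; apply: val_inj.
Qed.

Lemma mtype_le_trans (lam mu nu : mtype R) :
  mtype_le lam mu -> mtype_le mu nu -> mtype_le lam nu.
Proof.
move=> lm [N nN [x mx]]; have [u _ lu] := mtype_le_ex lm mx.
by exists N => //; exists u.
Qed.

End Isomorphisms.

(** * Symmetric couples: extending and gluing isomorphisms *)

Section FinitelyManySubmodules.
Variable R : pzRingType.
Implicit Type M : lmodType R.

(** A generator of each cyclic submodule yields a finite generating set. *)
Lemma finite_submodules_fingen M : finite_set [set: submodule M] -> fingen M.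
Proof.
move=> finM.
pose gen (u : submodule M) : M :=
  if pselect (exists v, u = span [set v]) is left e then projT1 (cid e) else 0.
exists (map gen (enum_fset (fset_set [set: submodule M]))) => v.
have spE : span [set v] = span [set gen (span [set v])].
  rewrite /gen; case: pselect => [e|[]]; last by exists v.
  by case: (cid e).
have : v \in span [set v] by exact: span_subset.
rewrite spE; apply: span_min => w ->; apply: span_subset.
by apply/mapP; exists (span [set v]); rewrite // in_fset_set// inE.
Qed.

Lemma finite_submodules_sub M (x : submodule M) :
  finite_set [set: submodule M] -> finite_set [set: submodule (subm x)].
Proof.
move=> finM.
apply: (sub_finite_set (B := @submod_out R M x @^-1` setT)) => //.
by apply: finite_preimage finM => u v _ _ e; rewrite -[u]submod_outK e submod_outK.
Qed.

Lemma submod_fingen M (x : submodule M) :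
  finite_set [set: submodule M] -> fingen (subm x).
Proof. by move=> fM; apply/finite_submodules_fingen/finite_submodules_sub. Qed.

End FinitelyManySubmodules.

Section Gluing.
Variable R : pzRingType.
Implicit Types (M : lmodType R) (phi : mtype R).

(** Symmetry of [phi], read on submodules of a common module. *)
Lemma symmetric_extend phi M (f1 f2 u1 u2 : submodule M)
    (h : {linear subm u1 -> subm u2}) :
  mtype_symmetric phi -> has_type phi (subm f1) -> has_type phi (subm f2) ->
  {subset u1 <= f1} -> {subset u2 <= f2} ->
  fingen (subm u1) -> fingen (subm u2) -> bijective h ->
  exists2 g : {linear subm f1 -> subm f2}, bijective g &
    forall (v : subm f1) (w : subm u1), val v = val w -> val (g v) = val (h w).
Proof.
move=> sym f1P f2P uf1 uf2 fg1 fg2 bh.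
have [i1 /[dup] bi1 /linear_inverse[j1 [ij1 ji1]]] :
    exists2 i : {linear subm (submod_in f1 u1) -> subm u1}, bijective i &
      forall w, val (i w) = val (val w).
  have il : linear (fun w : subm (submod_in f1 u1) =>
      exist (fun v => v \in submod_pred u1) (val (val w)) (valP w) : subm u1).
    by move=> a v w; apply: val_inj.
  exists (mk_linear il) => //.
  exists (fun v => exist (fun w => w \in submod_pred (submod_in f1 u1))
    (submod_incl uf1 v) (valP v)).
    by move=> w; do 2!apply: val_inj.
  by move=> w; apply: val_inj.
move=> i1E.
have il : linear (fun v : subm u2 => exist (fun w => w \in submod_pred (submod_in f2 u2))
    (submod_incl uf2 v) (valP v) : subm (submod_in f2 u2)).
  by move=> a v w; do 2!apply: val_inj.
pose i2 := mk_linear il.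
have bi2 : bijective i2.
  exists (fun w => exist (fun v => v \in submod_pred u2) (val (val w)) (valP w)).
    by move=> w; apply: val_inj.
  by move=> w; do 2!apply: val_inj.
have [|||g bg gE] := sym _ _ f1P f2P (submod_in f1 u1) (submod_in f2 u2) _ _
  (i2 \o h \o i1).
- exact: isomorphic_fingen (submod_in_iso uf1) fg1.
- exact: isomorphic_fingen (submod_in_iso uf2) fg2.
- by apply: bij_comp bi1; apply: bij_comp bi2 bh.
exists g => // v w vw.
have vE : v = val (j1 w) by apply: val_inj; rewrite -i1E ji1.
by rewrite vE gE /= ji1.
Qed.

(** The square formed by [x \cap f], [x], [f] and [x + f] is a pushout. *)
Definition sum_pushout M (x f : submodule M) :=
  is_pushout (submod_incl (@submod_capl _ _ x f)) (submod_incl (@submod_capr _ _ x f))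
             (submod_incl (@submod_addl _ _ x f)) (submod_incl (@submod_addr _ _ x f)).

(** Linear maps out of [x1] and [f1] that agree on the intersection extend to
    the sum. *)
Lemma pushout_map M (x1 f1 x2 f2 : submodule M)
    (h : {linear subm x1 -> subm x2}) (k : {linear subm f1 -> subm f2}) :
  sum_pushout x1 f1 ->
  (forall (v : subm x1) (w : subm f1), val v = val w -> val (h v) = val (k w)) ->
  exists d : {linear subm (submod_add x1 f1) -> subm (submod_add x2 f2)},
    (forall v, d (submod_incl (@submod_addl _ _ x1 f1) v) =
               submod_incl (@submod_addl _ _ x2 f2) (h v)) /\
    (forall v, d (submod_incl (@submod_addr _ _ x1 f1) v) =
               submod_incl (@submod_addr _ _ x2 f2) (k v)).
Proof.
move=> [_ univ] hk.
have [|d [dh dk _]] := univ _ (submod_incl (@submod_addl _ _ x2 f2) \o h)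
  (submod_incl (@submod_addr _ _ x2 f2) \o k).
  by move=> a; apply: val_inj => /=; apply: hk.
by exists d.
Qed.

Lemma pushout_id M (x f : submodule M)
    (d : {linear subm (submod_add x f) -> subm (submod_add x f)}) :
  sum_pushout x f ->
  (forall v, d (submod_incl (@submod_addl _ _ x f) v) =
             submod_incl (@submod_addl _ _ x f) v) ->
  (forall v, d (submod_incl (@submod_addr _ _ x f) v) =
             submod_incl (@submod_addr _ _ x f) v) -> d =1 id.
Proof.
move=> [comm univ] dx df w.
have [e [_ _ eP]] := univ _ _ _ comm.
rewrite (eP d dx df); apply/esym.
exact: (eP (idfun : {linear _ -> _})).
Qed.

Lemma pushout_bij M (x1 f1 x2 f2 : submodule M)
    (h : {linear subm x1 -> subm x2}) (k : {linear subm f1 -> subm f2}) :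
  sum_pushout x1 f1 -> sum_pushout x2 f2 -> bijective h -> bijective k ->
  (forall (v : subm x1) (w : subm f1), val v = val w <-> val (h v) = val (k w)) ->
  exists2 d : {linear subm (submod_add x1 f1) -> subm (submod_add x2 f2)},
    bijective d &
    (forall v, val (d (submod_incl (@submod_addl _ _ x1 f1) v)) = val (h v)) /\
    (forall v, val (d (submod_incl (@submod_addr _ _ x1 f1) v)) = val (k v)).
Proof.
move=> po1 po2 /linear_inverse[h' [hh' h'h]] /linear_inverse[k' [kk' k'k]] hk.
have [d [dh dk]] := pushout_map po1 (fun v w => (hk v w).1).
have hk' v w : val v = val w -> val (h' v) = val (k' w).
  by move=> vw; apply/hk; rewrite h'h k'k.
have [d' [dh' dk']] := pushout_map po2 hk'.
exists d; last by split=> v; rewrite ?dh ?dk.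
exists d' => w.
  by apply: (pushout_id (d := d' \o d) po1) => v /=; rewrite ?dh ?dk ?dh' ?dk' ?hh' ?kk'.
by apply: (pushout_id (d := d \o d') po2) => v /=; rewrite ?dh' ?dk' ?dh ?dk ?h'h ?k'k.
Qed.

End Gluing.

Section Couple.
Variables (R : pzRingType) (Phi phi : mtype R) (F : lmodType R).
Hypothesis couple : symmetric_couple Phi phi.
Hypothesis F_type : has_type Phi F.
Hypothesis finF : finite_set [set: submodule F].
Implicit Types x y f u : submodule F.

Let fg x : fingen (subm x). Proof. exact: submod_fingen. Qed.

(** The type of a submodule of [F]. *)
Definition subtype x : mtype R := mtype_of (fg x).

Lemma subtypeP x : has_type (subtype x) (subm x).
Proof. exact: mtype_ofP. Qed.

Lemma has_subtype lam x : has_type lam (subm x) <-> subtype x = lam.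
Proof.
split=> [lx|<-]; last exact: subtypeP.
exact: mtype_eq (subtypeP x) lx.
Qed.

(** Isomorphisms between submodules of [F] extend to automorphisms of [F]. *)
Lemma iso_extend x y (h : {linear subm x -> subm y}) : bijective h ->
  exists g : aut F, forall v, g (val v) = val (h v).
Proof.
move=> bh; have [symPhi _ _ _] := couple.
have [g bg gE] := symPhi F F F_type F_type x y (fg x) (fg y) h bh.
by exists (Aut bg).
Qed.

(** [g] carries [x] onto [y] when [x] is the preimage of [y]. *)
Lemma preim_aut_eq (g : aut F) x y :
  (forall v, (g v \in y) = (v \in x)) -> submod_preim g y = x.
Proof. by move=> gxy; apply: submodP => v; rewrite inE/= gxy. Qed.

Lemma iso_extend_mem x y (h : {linear subm x -> subm y}) (g : aut F) :
  bijective h -> (forall v, g (val v) = val (h v)) ->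
  forall v, (g v \in y) = (v \in x).
Proof.
move=> /linear_inverse[h' [hh' h'h]] gh v; apply/idP/idP => [gvy|vx].
  pose w : subm y := exist (fun w => w \in submod_pred y) (g v) gvy.
  have -> : v = val (h' w).
    by apply: (bij_inj (aut_bij g)); rewrite gh h'h.
  exact: valP.
pose w : subm x := exist (fun w => w \in submod_pred x) v vx.
rewrite -[v]/(val w) gh; exact: valP.
Qed.

Lemma subtype_preim (g : aut F) x : subtype (submod_preim g x) = subtype x.
Proof.
apply/has_subtype; apply: has_type_iso (subtypeP x) _.
exact: submod_preim_bij_iso (aut_bij g).
Qed.

(** Submodules of [F] of the same type are conjugate under [aut F]. *)
Lemma subtype_conj x y : subtype x = subtype y ->
  exists g : aut F, submod_preim g y = x.
Proof.
move=> xy.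
have [h bh] : isomorphic (subm x) (subm y).
  by apply: has_type_isomorphic (subtypeP x) _; rewrite xy; exact: subtypeP.
have [g gh] := iso_extend bh; exists g; apply: preim_aut_eq.
exact: iso_extend_mem bh gh.
Qed.

Lemma sum_pushoutP x f : has_type phi (subm f) -> mtype_le (subtype x) phi ->
  sum_pushout x f.
Proof.
move=> fP xP; have [_ _ _ /(_ F f phi F_type fP (mtype_le_refl _))[_]] := couple.
by move=> /(_ x (subtype x) (subtypeP x) xP).
Qed.

(** Extend [h] restricted to the intersections to an isomorphism of [f1] onto
    [f2], glue it with [h] along the pushout, and extend the result to [F]. *)
Lemma glue x1 x2 f1 f2 (h : {linear subm x1 -> subm x2}) :
  has_type phi (subm f1) -> has_type phi (subm f2) ->
  mtype_le (subtype x1) phi -> mtype_le (subtype x2) phi ->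
  bijective h -> (forall v, (val (h v) \in f2) = (val v \in f1)) ->
  exists g : aut F, (forall v, g (val v) = val (h v)) /\ submod_preim g f2 = f1.
Proof.
move=> f1P f2P x1P x2P /[dup] bh /linear_inverse[h' [hh' h'h]] hf.
have [_ symphi _ _] := couple.
have rP (w : subm (submod_cap x1 f1)) :
    val (h (submod_incl (@submod_capl _ _ x1 f1) w)) \in submod_pred (submod_cap x2 f2).
  by rewrite in_submod_cap subm_mem hf; have /andP[] := valP w.
have rl : linear (fun w => exist (fun v => v \in submod_pred (submod_cap x2 f2)) _ (rP w)
    : subm (submod_cap x2 f2)).
  by move=> a v w; apply: val_inj; rewrite /= !linearP.
have br : bijective (mk_linear rl).
  have rP' (w : subm (submod_cap x2 f2)) :
      val (h' (submod_incl (@submod_capl _ _ x2 f2) w)) \in submod_pred (submod_cap x1 f1).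
    by rewrite in_submod_cap subm_mem -hf h'h; have /andP[] := valP w.
  exists (fun w => exist (fun v => v \in submod_pred (submod_cap x1 f1)) _ (rP' w)).
    move=> w; apply: val_inj => /=; rewrite -[RHS]/(val (submod_incl (@submod_capl _ _ x1 f1) w)).
    by rewrite -[in RHS](hh' (submod_incl _ w)); congr (val (h' _)); apply: val_inj.
  move=> w; apply: val_inj => /=; rewrite -[RHS]/(val (submod_incl (@submod_capl _ _ x2 f2) w)).
  by rewrite -[in RHS](h'h (submod_incl _ w)); congr (val (h _)); apply: val_inj.
have [k bk kE] := symmetric_extend (h := mk_linear rl) symphi f1P f2P
  (@submod_capr _ _ x1 f1) (@submod_capr _ _ x2 f2) (fg _) (fg _) br.
have hk v w : val v = val w <-> val (h v) = val (k w).
  have key (v0 : subm x1) (w0 : subm f1) : val v0 = val w0 -> val (h v0) = val (k w0).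
    move=> vw; have vP : val v0 \in submod_pred (submod_cap x1 f1).
      by rewrite in_submod_cap subm_mem vw subm_mem.
    rewrite (kE w0 (exist (fun v => v \in submod_pred (submod_cap x1 f1)) _ vP))//=.
    by congr (val (h _)); apply: val_inj.
  split=> [/key//|vw].
  have vf : val v \in submod_pred f1 by rewrite -hf vw subm_mem.
  rewrite -[val v]/(val (exist (fun v => v \in submod_pred f1) _ vf : subm f1)).
  congr (val _); apply: (bij_inj bk); apply: val_inj; rewrite -vw.
  by apply/esym/key.
have [d bd [dh dk]] := pushout_bij (sum_pushoutP f1P x1P) (sum_pushoutP f2P x2P) bh bk hk.
have [g gd] := iso_extend bd; exists g; split=> [v|].
  by rewrite -dh -gd.
apply: preim_aut_eq; apply: iso_extend_mem bk _ => v.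
by rewrite -dk -gd.
Qed.

(** [aut F] acts on pairs of submodules of type [phi] with orbits classified by
    the type of the intersection. *)
Lemma pair_conj y1 y1' y2 y2' :
  has_type phi (subm y1) -> has_type phi (subm y1') ->
  has_type phi (subm y2) -> has_type phi (subm y2') ->
  subtype (submod_cap y1 y1') = subtype (submod_cap y2 y2') ->
  exists g : aut F, submod_preim g y2 = y1 /\ submod_preim g y2' = y1'.
Proof.
move=> y1P y1P' y2P y2P' yy; have [_ symphi _ _] := couple.
have [h bh] : isomorphic (subm (submod_cap y1 y1')) (subm (submod_cap y2 y2')).
  by apply: has_type_isomorphic (subtypeP _) _; rewrite yy; exact: subtypeP.
have [k bk kE] := symmetric_extend symphi y1P y2P
  (@submod_capl _ _ y1 y1') (@submod_capl _ _ y2 y2') (fg _) (fg _) bh.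
have le y : has_type phi (subm y) -> mtype_le (subtype y) phi.
  by move=> /has_subtype ->; exact: mtype_le_refl.
have [|g [gk gy]] := glue y1P' y2P' (le _ y1P) (le _ y2P) bk.
  move=> v; have [h' [hh' h'h]] := linear_inverse bh; have [k' [kk' k'k]] := linear_inverse bk.
  apply/idP/idP => vy; last first.
    have vP : val v \in submod_pred (submod_cap y1 y1') by rewrite in_submod_cap subm_mem.
    rewrite (kE v (exist (fun v => v \in submod_pred (submod_cap y1 y1')) _ vP))//.
    by have /andP[] := valP (h (exist (fun v => v \in submod_pred (submod_cap y1 y1')) _ vP)).
  have vP : val (k v) \in submod_pred (submod_cap y2 y2') by rewrite in_submod_cap subm_mem.
  pose w := h' (exist (fun v => v \in submod_pred (submod_cap y2 y2')) _ vP).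
  have /andP[w1 w2] := valP w.
  suff -> : v = submod_incl (@submod_capl _ _ y1 y1') w by [].
  apply: (bij_inj bk); apply: val_inj; rewrite (kE (submod_incl _ w) w)//.
  by rewrite h'h.
exists g; split=> //; apply: preim_aut_eq; exact: iso_extend_mem bk gk.
Qed.

(** Only [x \cap y] matters for the orbit of [y] under the stabiliser of [x]. *)
Lemma stab_conj x y y' : mtype_le (subtype x) phi ->
  has_type phi (subm y) -> has_type phi (subm y') ->
  submod_cap x y = submod_cap x y' ->
  exists g : aut F, submod_preim g x = x /\ submod_preim g y' = y.
Proof.
move=> xP yP yP' xy.
have bid : bijective (idfun : {linear subm x -> subm x}) by exists id.
have [|g [gx gy]] := glue yP yP' xP xP bid.
  move=> v; have := congr1 (fun u => val v \in u) xy.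
  by rewrite !in_submod_cap subm_mem.
by exists g; split=> //; apply: preim_aut_eq; exact: iso_extend_mem bid gx.
Qed.

(** Every submodule of [y] is cut out by another submodule of type [phi]: the
    couple provides an intersection of the right type, and an automorphism of
    [y], extended to [F], moves it to [u]. *)
Lemma cap_surj y u : has_type phi (subm y) -> {subset u <= y} ->
  exists2 y', has_type phi (subm y') & submod_cap y y' = u.
Proof.
move=> yP uy; have [_ symphi _ cp] := couple.
have [[z [zP zu]] _] := cp F y (subtype u) F_type yP (mtype_le_sub (subtypeP u) yP uy).
have [h bh] := has_type_isomorphic (subtypeP u) zu.
have [k bk kE] := symmetric_extend symphi yP yP uy (@submod_capl _ _ y z) (fg _) (fg _) bh.
have [g gk] := iso_extend bk; exists (submod_preim g z).
  exact: has_type_iso zP (submod_preim_bij_iso _ (aut_bij g)).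
have gh v : g (val v) = val (h v).
  by rewrite -(kE (submod_incl uy v))// -gk.
apply: submodP => v.
rewrite -(iso_extend_mem bh gh v) !inE/=.
by rewrite (iso_extend_mem bk gk v).
Qed.

Lemma has_phi_ex : exists y, has_type phi (subm y).
Proof.
have [_ _ [M MP [x xP]] _] := couple.
have [f /[dup] bf /linear_inverse [f' [ff' f'f]]] := has_type_isomorphic F_type MP.
by exists (submod_preim f x); exact: has_type_iso xP (submod_preim_bij_iso _ bf).
Qed.

Lemma mtype_le_subtype lam y : has_type phi (subm y) -> mtype_le lam phi ->
  exists2 x : submodule F, {subset x <= y} & subtype x = lam.
Proof.
move=> yP /mtype_le_ex/(_ yP)[x xy /has_subtype xl].
by exists x.
Qed.

End Couple.

(** * Finite sums and Moebius inversion *)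

(** A copy of a type with finitely many elements, carrying a [finType]
    structure so that sums over it are ordinary finite sums. *)
Definition fin_of (T : choiceType) (finT : finite_set [set: T]) : Type := T.

Section FinOf.
Variables (T : choiceType) (finT : finite_set [set: T]).

HB.instance Definition _ := Choice.copy (fin_of finT) T.

Let e : seq (fin_of finT) := fset_set [set: T].

Let mem_e x : x \in e.
Proof.
by have : (x : T) \in fset_set [set: T] by rewrite in_fset_set// inE.
Qed.

Fact fin_of_pcancel : pcancel (index^~ e) (onth e).
Proof.
move=> x; rewrite onthE (nth_map x) ?index_mem ?mem_e//.
by rewrite nth_index ?mem_e.
Qed.
HB.instance Definition _ := isCountable.Build (fin_of finT) fin_of_pcancel.

Fact fin_of_enumP : Finite.axiom e.
Proof.
by move=> x; rewrite count_uniq_mem ?mem_e//; exact: (fset_uniq (fset_set [set: T])).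
Qed.
HB.instance Definition _ := isFinite.Build (fin_of finT) fin_of_enumP.

Lemma fsbig_fin_of (V : nmodType) (A : set T) (f : T -> V) :
  \sum_(x \in A) f x = \sum_(x : fin_of finT | x \in A) f x.
Proof.
rewrite fsbig_finite; last exact: sub_finite_set finT.
rewrite -[RHS]big_filter; apply: perm_big; apply: uniq_perm.
- exact: fset_uniq.
- by apply: filter_uniq; exact: (index_enum_uniq (fin_of finT)).
- move=> x; rewrite in_fset_set; last exact: sub_finite_set finT.
  by rewrite mem_filter [X in _ && X](mem_index_enum (x : fin_of finT)) andbT.
Qed.
End FinOf.

Section Moebius.
Variables (S : finType) (le : rel S) (V : zmodType).
Hypotheses (le_refl : reflexive le) (le_anti : antisymmetric le)
  (le_trans : transitive le).

Let down_lt u w : le u w -> u != w -> (#|[pred v | le v u]| < #|[pred v | le v w]|)%N.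
Proof.
move=> uw neq; apply: proper_card; apply/properP; split.
  by apply/fintype.subsetP => v; rewrite !inE => /le_trans; exact.
exists w; rewrite inE ?le_refl//; apply: contra neq => wu.
by apply/eqP/le_anti; rewrite uw.
Qed.

(** Moebius inversion over a finite poset. *)
Lemma moebius_ex (k : S -> V) :
  exists m : S -> V, forall w, k w = \sum_(u | le u w) m u.
Proof.
suff [m mP] : exists m : S -> V, forall w, (#|[pred v | le v w]| < #|S|.+1)%N ->
    k w = \sum_(u | le u w) m u.
  by exists m => w; apply: mP; rewrite ltnS max_card.
elim: #|S|.+1 => [|n [m mP]]; first by exists (fun=> 0).
pose c w := #|[pred v | le v w]|.
(* The coefficients are built by induction on the number of elements below;
   [m] is already right for those with fewer than [n], themselves included. *)
exists (fun w => if c w == n then k w - \sum_(u | le u w && (u != w)) m u else m w).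
move=> w; rewrite ltnS leq_eqVlt => cw.
rewrite (bigD1 w) ?le_refl//=.
have -> : \sum_(u | le u w && (u != w))
    (if c u == n then k u - \sum_(v | le v u && (v != u)) m v else m u) =
    \sum_(u | le u w && (u != w)) m u.
  apply: eq_bigr => u /andP[uw neq]; rewrite ifF//; apply/eqP => cu.
  have := down_lt uw neq; rewrite -/(c u) cu ltnNge.
  by case/orP: cw => [/eqP ->|/ltnW ->]; rewrite ?leqnn.
case: eqP => [|neq]; first by rewrite subrK.
rewrite mP; first by rewrite (bigD1 w) ?le_refl.
by case/orP: cw => // /eqP.
Qed.

(** Moebius inversion is unique on the elements below a given [y]. *)
Lemma moebius_uniq (m : S -> V) y :
  (forall w, le w y -> \sum_(u | le u w) m u = 0) -> forall w, le w y -> m w = 0.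
Proof.
move=> m0 w; have [n] := ubnP #|[pred v | le v w]|.
elim: n w => // n IHn w; rewrite ltnS => cw wy.
have := m0 w wy; rewrite (bigD1 w) ?le_refl//= big1 ?addr0// => u /andP[uw neq].
apply: IHn; last exact: le_trans wy.
exact: leq_trans (down_lt uw neq) cw.
Qed.
End Moebius.

(** * Kernels of the Hecke algebra *)

Section Kernels.
Variables (R : pzRingType) (Phi phi : mtype R) (F : lmodType R).
Hypothesis couple : symmetric_couple Phi phi.
Hypothesis F_type : has_type Phi F.
Hypothesis finF : finite_set [set: submodule F].

Local Notation X := (@submods R F phi).
Local Notation H := (hecke F phi).
Local Notation S := (fin_of finF).
Local Notation ty := (subtype finF).
Local Notation cap := submod_cap.
Implicit Types (S T : H) (y z : X) (u w x : S).

Lemma submods_finite lam : finite_set [set: @submods R F lam].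
Proof.
apply: (sub_finite_set (B := @sval _ _ @^-1` [set: submodule F])) => //.
by apply: finite_preimage finF => u v _ _ uv; apply: val_inj.
Qed.
Local Notation finX lam := (fin_of (submods_finite lam)).

Lemma submodsP lam (y : @submods R F lam) : has_type lam (subm (val y)).
Proof. by have := valP y; rewrite inE. Qed.

(** Inclusion of submodules, as a boolean relation. *)
Definition sub_rel (u w : submodule F) : bool := `[< {subset u <= w} >].

Lemma sub_relP u w : reflect {subset u <= w} (sub_rel u w).
Proof. exact: asboolP. Qed.

Lemma sub_rel_refl : reflexive sub_rel.
Proof. by move=> u; apply/asboolP. Qed.

Lemma sub_rel_anti : antisymmetric sub_rel.
Proof.
move=> u w /andP[/asboolP uw /asboolP wu]; apply: submodP => v.
by apply/idP/idP; [exact: uw|exact: wu].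
Qed.

Lemma sub_rel_trans : transitive sub_rel.
Proof. by move=> u w x /asboolP wu /asboolP ux; apply/asboolP => v /wu/ux. Qed.

Lemma sub_rel_cap u v w : sub_rel u (cap v w) = sub_rel u v && sub_rel u w.
Proof.
apply/asboolP/andP => [uvw|[/asboolP uv /asboolP uw] r ru].
  by split; apply/asboolP => r /uvw/andP[].
by rewrite in_submod_cap uv ?uw.
Qed.

Lemma capC (u w : submodule F) : cap u w = cap w u.
Proof. by apply: submodP => v; rewrite !in_submod_cap andbC. Qed.

Lemma sub_rel_preim (g : aut F) u w :
  sub_rel (submod_preim g u) (submod_preim g w) = sub_rel u w.
Proof.
have [h [gh hg]] := aut_inv_subproof g.
apply/asboolP/asboolP => uw v; last by rewrite !inE/=; exact: uw.
by have := uw (h v); rewrite !inE/= hg.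
Qed.

Lemma preim_inj (g : aut F) : injective (submod_preim g).
Proof.
have [h [gh hg]] := aut_inv_subproof g => u w uw; apply: submodP => v.
by have := congr1 (fun z : submodule F => h v \in z) uw; rewrite !inE/= hg.
Qed.

(** The indicator function of [y]. *)
Definition delta (y : X) : X -> rat^o := fun z => (z == y)%:R.

(** The matrix of an element of the Hecke algebra in the basis of indicator
    functions. *)
Definition kernel T (y y' : X) : rat := T (delta y') y.

Lemma kernelE T (h : X -> rat^o) y :
  T h y = \sum_(y' : finX phi) kernel T y y' * h y'.
Proof.
have dE (a : rat) (y1 y2 : X) : (a *: delta y1) y2 = a * (y2 == y1)%:R by [].
have hE : h = \sum_(y' : finX phi) (h y' : rat) *: delta y'.
  apply/funext => z; rewrite fct_sumE (bigD1 (z : finX phi))// big1 => [|z' neq].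
    by rewrite Monoid.mulm1 dE eqxx mulr1.
  by rewrite dE eq_sym (negPf neq) mulr0.
rewrite [in LHS]hE linear_sum fct_sumE; apply: eq_bigr => y' _.
by rewrite linearZ mulrC.
Qed.

Lemma kernel_inj S T : (forall y y', kernel S y y' = kernel T y y') -> S = T.
Proof.
move=> ST; apply: heckeP => h; apply/funext => y; rewrite !kernelE.
by apply: eq_bigr => y' _; rewrite ST.
Qed.

Lemma kernelM S T y y' :
  kernel (S * T) y y' = \sum_(z : finX phi) kernel S y z * kernel T z y'.
Proof. by rewrite -[LHS]/(S (T (delta y')) y) kernelE. Qed.

Lemma kernel0 y y' : kernel 0 y y' = 0. Proof. by []. Qed.

Lemma kernel_lin (J : finType) (a : J -> rat) (T : J -> H) y y' :
  kernel (\sum_j a j *: T j) y y' = \sum_j a j * kernel (T j) y y'.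
Proof.
elim/big_ind2 : _ => // S s S' s' eS eS'.
by rewrite -eS -eS'.
Qed.

Lemma kernel_aut T (g : aut F) y y' :
  kernel T (aut_inv_act g y) (aut_inv_act g y') = kernel T y y'.
Proof.
rewrite /kernel -[LHS]/(aut_act g (T (delta (aut_inv_act g y'))) y).
rewrite -hecke_equivariant; congr (T _ _); apply/funext => z.
rewrite /aut_act /delta; congr (_%:R); congr nat_of_bool.
apply/eqP/eqP => [/(congr1 val)/preim_inj/val_inj//|-> //].
Qed.

Lemma kernel_preim T (g : aut F) y1 y1' y2 y2' :
  submod_preim g (val y2) = val y1 -> submod_preim g (val y2') = val y1' ->
  kernel T y1 y1' = kernel T y2 y2'.
Proof.
move=> e e'; rewrite -(kernel_aut T g y2 y2').
by congr kernel; apply: val_inj.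
Qed.

(** The kernel depends only on the type of the intersection. *)
Lemma kernel_subtype T y1 y1' y2 y2' :
  ty (cap (val y1) (val y1')) = ty (cap (val y2) (val y2')) ->
  kernel T y1 y1' = kernel T y2 y2'.
Proof.
move=> /(pair_conj couple F_type).
case/(_ (submodsP _) (submodsP _) (submodsP _) (submodsP _)) => g [].
exact: kernel_preim.
Qed.

Lemma kernel_sym T y y' : kernel T y y' = kernel T y' y.
Proof. by apply: kernel_subtype; rewrite capC. Qed.

(** Gelfand's trick: symmetric matrices closed under products commute. *)
Lemma hecke_mulC S T : S * T = T * S.
Proof.
apply: kernel_inj => y y'; rewrite [RHS]kernel_sym !kernelM.
by apply: eq_bigr => z _; rewrite mulrC kernel_sym (kernel_sym S).
Qed.

Lemma hecke_reduced T : T * T = 0 -> T = 0.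
Proof.
move=> TT; apply: kernel_inj => y y'; rewrite kernel0.
have /eqP : \sum_(z : finX phi) kernel T y z ^+ 2 = 0.
  rewrite -[RHS](kernel0 y y) -TT kernelM; apply: eq_bigr => z _.
  by rewrite expr2 (kernel_sym T z).
rewrite Num.Theory.psumr_eq0 => [/allP/(_ y')|z _]; last exact: Num.Theory.sqr_ge0.
by rewrite mem_index_enum sqrf_eq0 => /(_ isT)/eqP.
Qed.

(** Sums over the submodules of type [lam] as sums over all submodules. *)
Lemma sum_submods (lam : mtype R) (f : submodule F -> rat) (p : pred (submodule F)) :
  \sum_(x : finX lam | p (val x)) f (val x) =
  \sum_(u : S | p u && `[< ty u = lam >]) f u.
Proof.
rewrite (reindex_omap (val : finX lam -> S) insub)/=.
  apply: eq_bigl => x; rewrite valK eqxx andbT.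
  rewrite (_ : `[< _ >] = true) ?andbT//.
  by apply/asboolP/(has_subtype finF); exact: submodsP.
move=> u /andP[_ /asboolP/(has_subtype finF) ul].
by rewrite insubT// inE.
Qed.

Lemma cellopE lam (h : X -> rat^o) y :
  cellop finF phi lam h y =
  \sum_(x : S | sub_rel x (val y) && `[< ty x = lam >])
    \sum_(z : finX phi | sub_rel x (val z)) h z.
Proof.
rewrite /= /T_up (fsbig_fin_of (submods_finite lam)).
rewrite -(sum_submods lam (fun x => \sum_(z : finX phi | sub_rel x (val z)) h z)
  (fun x => sub_rel x (val y))).
apply: eq_big => [x|x _]; first by rewrite /= /sub_rel; apply/idP/asboolP; rewrite inE.
rewrite /T_down (fsbig_fin_of (submods_finite phi)).
by apply: eq_bigl => z; rewrite /= /sub_rel; apply/idP/asboolP; rewrite inE.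
Qed.

(** The matrix entry of [c_lam] counts the submodules of type [lam] of the
    intersection. *)
Lemma kernel_cellop lam y y' : kernel (cellop finF phi lam) y y' =
  \sum_(u : S | sub_rel u (cap (val y) (val y'))) `[< ty u = lam >]%:R.
Proof.
rewrite /kernel cellopE big_mkcondr [RHS]big_mkcond [LHS]big_mkcond/=.
apply: eq_bigr => u _; rewrite sub_rel_cap.
case: ifP => //= uy; case: asboolP => _; last by case: ifP.
rewrite /delta; case: ifP => uy'.
  rewrite (bigD1 (y' : finX phi))//= eqxx big1 ?addr0// => z /andP[_ /negPf ->//].
rewrite big1// => z uz; case: eqP => // zy; by rewrite zy uy' in uz.
Qed.

(** Fixing [x], the sum of the kernel over the [z] containing [x] depends on
    [y'] only through [x \cap y']. *)
Lemma kernel_sum_cap T x y y' : mtype_le (ty x) phi ->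
  cap x (val y) = cap x (val y') ->
  \sum_(z : finX phi | sub_rel x (val z)) kernel T z y =
  \sum_(z : finX phi | sub_rel x (val z)) kernel T z y'.
Proof.
move=> xP /(stab_conj couple F_type xP (submodsP _) (submodsP _))[g [gx gy]].
rewrite [LHS](reindex_inj (h := aut_inv_act g : finX phi -> finX phi)); last first.
  by move=> z z' /(congr1 val)/preim_inj/val_inj.
apply: eq_big => [z|z _] /=; first by rewrite -[in LHS]gx sub_rel_preim.
exact: kernel_preim gy.
Qed.

(** The matrix entries of [T] are the partial sums of an invariant function
    over the submodules of the intersection. *)
Lemma kernel_moebius T : exists m : S -> rat,
  (forall u w, ty u = ty w -> m u = m w) /\
  forall y y', kernel T y y' =
    \sum_(u : S | sub_rel u (cap (val y) (val y'))) m u.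
Proof.
(* [k] is the matrix entry as a function of the type of the intersection; its
   value on types that are not reached is irrelevant. *)
pose k (lam : mtype R) : rat :=
  if pselect (exists p : X * X, ty (cap (val p.1) (val p.2)) = lam) is left e
  then kernel T (projT1 (cid e)).1 (projT1 (cid e)).2 else 0.
have kE y y' : kernel T y y' = k (ty (cap (val y) (val y'))).
  rewrite /k; case: pselect => [e|[]]; last by exists (y, y').
  by apply: kernel_subtype; rewrite (projT2 (cid e)).
have [m mP] := moebius_ex (S := S) sub_rel_refl sub_rel_anti sub_rel_trans (fun w => k (ty w)).
exists m; split=> [u w uw|y y']; last by rewrite kE mP.
(* An automorphism carrying [u] to [w] transports [m] to another solution of
   the same inversion problem. *)
have [g gu] := subtype_conj couple F_type uw.
rewrite -gu; apply/eqP; rewrite -subr_eq0; apply/eqP.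
apply: (moebius_uniq (S := S) sub_rel_refl sub_rel_anti sub_rel_trans
  (m := fun w => m (submod_preim g w) - m w) (y := w)); last exact: sub_rel_refl.
move=> v _; rewrite sumrB -mP -(subtype_preim finF g v) mP.
rewrite [X in _ - X](reindex_inj (h := submod_preim g : S -> S)); last exact: preim_inj.
apply/eqP; rewrite subr_eq0; apply/eqP; apply: eq_bigl => u' /=.
by rewrite sub_rel_preim.
Qed.

Lemma subtype_le y u : sub_rel u (val y) -> mtype_le (ty u) phi.
Proof. by move=> /asboolP; exact: mtype_le_sub (subtypeP _ u) (submodsP y). Qed.

Lemma submods_ex : inhabited X.
Proof.
have [y yP] := has_phi_ex couple F_type.
by exists; exact: (exist (fun v => v \in @submods R F phi) y (mem_set yP)).
Qed.

Lemma cap_surj_rel y u : sub_rel u (val y) ->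
  exists y' : X, cap (val y) (val y') = u.
Proof.
move=> /asboolP/(cap_surj couple F_type finF (submodsP y))[y' yP' <-].
by exists (exist (fun v => v \in @submods R F phi) y' (mem_set yP')).
Qed.

(** A kernel that is a sum, over the [x] of type [lam] inside [y], of functions
    of [x \cap y'], has Moebius coefficients supported on types below [lam]. *)
Lemma kernel_cellopM lam T y : mtype_le lam phi -> exists m : S -> rat,
  (forall u, sub_rel u (val y) -> ~ mtype_le (ty u) lam -> m u = 0) /\
  forall y', kernel (cellop finF phi lam * T) y y' =
    \sum_(u : S | sub_rel u (cap (val y) (val y'))) m u.
Proof.
move=> lamP.
(* The inner sum as a function of [w = x \cap y']; its value on the [w] that are
   not reached is irrelevant. *)
pose k (x w : S) : rat :=
  if pselect (exists y' : X, cap x (val y') = w) is left e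
  then \sum_(z : finX phi | sub_rel x (val z)) kernel T z (projT1 (cid e)) else 0.
have kE x y' : mtype_le (ty x) phi ->
    \sum_(z : finX phi | sub_rel x (val z)) kernel T z y' = k x (cap x (val y')).
  move=> xP; rewrite /k; case: pselect => [e|[]]; last by exists y'.
  by apply: kernel_sum_cap => //; rewrite (projT2 (cid e)).
have /choice[m mP] x : exists m : S -> rat, forall w, k x w = \sum_(u : S | sub_rel u w) m u.
  exact: (moebius_ex (S := S)) sub_rel_refl sub_rel_anti sub_rel_trans (k x).
exists (fun u => \sum_(x : S | [&& sub_rel u x, sub_rel x (val y) & `[< ty x = lam >]]) m x u).
split=> [u uy nle|y'].
  rewrite big1// => x /and3P[/asboolP ux /asboolP xy /asboolP xl]; case: nle.
  rewrite -xl; exact: mtype_le_sub (subtypeP _ u) (subtypeP _ x) ux.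
rewrite /kernel -[LHS]/(cellop finF phi lam (T (delta y')) y) cellopE.
transitivity (\sum_(x : S | sub_rel x (val y) && `[< ty x = lam >])
    \sum_(u : S | sub_rel u (cap x (val y'))) m x u).
  by apply: eq_bigr => x /andP[_ /asboolP xl]; rewrite -mP -kE ?xl.
rewrite (exchange_big_dep (fun u : S => sub_rel u (cap (val y) (val y'))))/=; last first.
  move=> x u /andP[xy _]; rewrite !sub_rel_cap => /andP[ux ->].
  by rewrite (sub_rel_trans ux xy).
apply: eq_bigr => u; rewrite sub_rel_cap => /andP[_ uy']; apply: eq_bigl => x.
by rewrite sub_rel_cap uy' andbT andbC.
Qed.

Section Basis.
(** [t] enumerates the types below [phi] without repetition. *)
Variables (I : finType) (t : I -> mtype R).
Hypothesis t_inj : injective t.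
Hypothesis t_le : forall i, mtype_le (t i) phi.
Hypothesis t_surj : forall lam, mtype_le lam phi -> exists i, t i = lam.

Local Notation c i := (cellop finF phi (t i)).

Lemma sum_index (a : I -> rat) u i : ty u = t i ->
  \sum_j a j * `[< ty u = t j >]%:R = a i.
Proof.
move=> ui; rewrite (bigD1 i)//= big1 => [|j ji].
  by rewrite addr0; case: asboolP => [_|[]]//; rewrite mulr1.
case: asboolP => [|_]; last by rewrite mulr0.
by rewrite ui => /t_inj ij; rewrite ij eqxx in ji.
Qed.

(** The coefficients of a combination of the [c i] are its Moebius
    coefficients. *)
Lemma kernel_comb (a : I -> rat) y y' : kernel (\sum_i a i *: c i) y y' =
  \sum_(u : S | sub_rel u (cap (val y) (val y')))
    \sum_j a j * `[< ty u = t j >]%:R.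
Proof.
rewrite kernel_lin exchange_big; apply: eq_bigr => i _.
by rewrite -mulr_sumr -kernel_cellop.
Qed.

(** The [c_lam] span the Hecke algebra. *)
Lemma cellop_coords T : exists a : I -> rat, T = \sum_i a i *: c i.
Proof.
have [m [m_ty mP]] := kernel_moebius T.
have [y] := submods_ex.
have /choice[r rP] i : exists u : S, ty u = t i.
  by have [u _ ut] := mtype_le_subtype finF (submodsP y) (t_le i); exists u.
exists (m \o r); apply: kernel_inj => {}y y'; rewrite mP kernel_comb.
apply: eq_bigr => u; rewrite sub_rel_cap => /andP[uy _].
have [i ti] := t_surj (subtype_le uy).
by rewrite (@sum_index _ u i)//=; apply: m_ty; rewrite rP.
Qed.

Lemma kernel_comb_coef (a : I -> rat) y (m : S -> rat) :
  (forall y', kernel (\sum_i a i *: c i) y y' =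
    \sum_(u : S | sub_rel u (cap (val y) (val y'))) m u) ->
  forall i u, sub_rel u (val y) -> ty u = t i -> a i = m u.
Proof.
move=> am i u uy ui; apply/eqP; rewrite -subr_eq0 -(sum_index a ui); apply/eqP.
apply: (moebius_uniq (S := S) sub_rel_refl sub_rel_anti sub_rel_trans
  (m := fun u => \sum_j a j * `[< ty u = t j >]%:R - m u) _ uy) => w.
move=> /cap_surj_rel[y' <-]; rewrite sumrB -am kernel_comb; exact: subrr.
Qed.

(** The [c_lam] are linearly independent. *)
Lemma cellop_free (a : I -> rat) : \sum_i a i *: c i = 0 -> forall i, a i = 0.
Proof.
move=> a0 i; have [y] := submods_ex.
have [u /asboolP uy ui] := mtype_le_subtype finF (submodsP y) (t_le i).
apply: (kernel_comb_coef (m := fun=> 0) _ uy ui) => y'.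
by rewrite a0 big1.
Qed.

(** [c_lam * T] only involves the [c_mu] with [mu <= lam]. *)
Lemma cellop_mul i T (a : I -> rat) : c i * T = \sum_j a j *: c j ->
  forall j, ~ mtype_le (t j) (t i) -> a j = 0.
Proof.
move=> ciT j nle; have [y] := submods_ex.
have [u /asboolP uy uj] := mtype_le_subtype finF (submodsP y) (t_le j).
have [m [m0 mP]] := kernel_cellopM T y (t_le i).
rewrite ciT in mP; rewrite (kernel_comb_coef mP uy uj).
by apply: m0 => //; rewrite uj.
Qed.

End Basis.

(** [mtype_le] is antisymmetric below [phi]: conjugate submodules of [F] contain
    equally many submodules. *)
Lemma mtype_le_anti lam mu : mtype_le mu phi ->
  mtype_le lam mu -> mtype_le mu lam -> lam = mu.
Proof.
move=> muP lm ml; have [y] := submods_ex.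
have [x _ xm] := mtype_le_subtype finF (submodsP y) muP.
have /has_subtype xP := xm.
have [u ux ul] := mtype_le_ex lm xP.
have [w wu wm] := mtype_le_ex ml ul.
have wx : {subset w <= x} by move=> v /wu/ux.
have [g gx] : exists g : aut F, submod_preim g x = w.
  by apply: (subtype_conj couple F_type (finF := finF)); rewrite xm; apply/has_subtype.
pose D (v : S) : {set S} := [set v' : S | sub_rel v' v].
have /eqP/setP/(_ x) : D w == D x.
  rewrite eqEcard; apply/andP; split.
    apply/fintype.subsetP => v; rewrite !finset.in_set => vw.
    by apply: sub_rel_trans vw _; apply/sub_relP.
  rewrite -(card_imset (D x) (f := submod_preim g : S -> S)); last exact: preim_inj.
  apply: subset_leq_card; apply/fintype.subsetP => _ /imsetP[v vx ->].
  by rewrite finset.in_set -gx sub_rel_preim; rewrite finset.in_set in vx.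
rewrite !finset.in_set sub_rel_refl => /sub_relP xw.
have xu : u = x by apply: submodP => v; apply/idP/idP => [/ux|/xw/wu].
by rewrite xu in ul; exact: mtype_eq ul xP.
Qed.

(** The types below [phi] are finitely many, being those of the submodules of a
    module of type [phi]. *)
Lemma mtype_enum : exists (I : finType) (t : I -> mtype R),
  [/\ injective t, forall i, mtype_le (t i) phi
    & forall lam, mtype_le lam phi -> exists i, t i = lam].
Proof.
have [y] := submods_ex.
(* A canonical representative of each isomorphism class of submodules. *)
pose rep (u : S) : S := odflt u [pick v : S | `[< ty v = ty u >]].
have repP u : ty (rep u) = ty u.
  by rewrite /rep; case: pickP => [v /asboolP//|/(_ u)/asboolP[]].
have repE u v : ty u = ty v -> rep u = rep v.
  move=> uv; rewrite /rep uv; case: pickP => // /(_ v) /asboolP[].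
  by [].
pose J : finType := {u : S | (rep u == u) && `[< mtype_le (ty u) phi >]}.
exists J, (fun u : J => ty (val u)).
split.
- move=> u v /repE; case/andP: (valP u) => /eqP -> _.
  by case/andP: (valP v) => /eqP -> _ /val_inj.
- by move=> u; case/andP: (valP u) => _ /asboolP.
- move=> lam lamP; have [u _ ul] := mtype_le_subtype finF (submodsP y) lamP.
  have uP : (rep (rep u) == rep u) && `[< mtype_le (ty (rep u)) phi >].
    by rewrite (repE (rep u) u) ?repP// eqxx ul; apply/asboolP.
  by exists (exist _ (rep u) uP); rewrite /= repP.
Qed.

End Kernels.

(** * Primitive idempotents *)

Section Idempotents.
Variables (R : pzRingType) (F : lmodType R) (phi : mtype R).
Local Notation H := (hecke F phi).
Implicit Types S T : H.

Lemma hecke_scaleAl a S T : a *: (S * T) = (a *: S) * T.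
Proof. exact: heckeP. Qed.

Lemma hecke_scaleAr a S T : a *: (S * T) = S * (a *: T).
Proof. by apply: heckeP => h; rewrite /= linearZ. Qed.

Variables (I : finType) (le : rel I) (c : I -> H).
Hypotheses (le_refl : reflexive le) (le_anti : antisymmetric le)
  (le_trans : transitive le).
Hypothesis mulC : forall S T, S * T = T * S.
Hypothesis reduced : forall T, T * T = 0 -> T = 0.
Hypothesis coords : forall T, exists a : I -> rat, T = \sum_i a i *: c i.
Hypothesis free : forall a : I -> rat, \sum_i a i *: c i = 0 -> forall i, a i = 0.
Hypothesis cmul : forall i T (a : I -> rat), c i * T = \sum_j a j *: c j ->
  forall j, ~~ le j i -> a j = 0.

(** The span of the [c i] for [i] in [D]. *)
Definition comb (D : {set I}) T := exists a : I -> rat,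
  (forall i, i \notin D -> a i = 0) /\ T = \sum_i a i *: c i.

(** Lower sets of the index poset. *)
Definition down_closed (D : {set I}) := forall i j, j \in D -> le i j -> i \in D.

Lemma comb0 D : comb D 0.
Proof.
by exists (fun=> 0); split=> //; rewrite big1// => i _; rewrite scale0r.
Qed.

Lemma combD D S T : comb D S -> comb D T -> comb D (S + T).
Proof.
move=> [a [aD ->]] [b [bD ->]]; exists (fun i => a i + b i); split.
  by move=> i iD; rewrite aD// bD// addr0.
by rewrite -big_split; apply: eq_bigr => i _; rewrite /= scalerDl.
Qed.

Lemma combZ D x T : comb D T -> comb D (x *: T).
Proof.
move=> [a [aD ->]]; exists (fun i => x * a i); split.
  by move=> i iD; rewrite aD// mulr0.
by rewrite scaler_sumr; apply: eq_bigr => i _; rewrite scalerA.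
Qed.

Lemma combB D S T : comb D S -> comb D T -> comb D (S - T).
Proof. by move=> DS DT; rewrite -scaleN1r; apply: combD => //; exact: combZ. Qed.

Lemma comb_sum D (J : Type) (r : seq J) (P : pred J) (T : J -> H) :
  (forall j, P j -> comb D (T j)) -> comb D (\sum_(j <- r | P j) T j).
Proof. move=> DT; apply: big_ind => //; [exact: comb0|exact: combD]. Qed.

Lemma comb_c (D : {set I}) i : i \in D -> comb D (c i).
Proof.
move=> iD; exists (fun j => (j == i)%:R); split=> [j|].
  by case: eqP => // ->; rewrite iD.
rewrite (bigD1 i)//= eqxx scale1r big1 ?addr0// => j /negPf ->.
by rewrite scale0r.
Qed.

Lemma comb_mono (D E : {set I}) T : D \subset E -> comb D T -> comb E T.
Proof.
move=> /fintype.subsetP DE [a [aD ->]]; exists a; split=> // i iE.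
by apply: aD; apply: contra iE; exact: DE.
Qed.

Lemma comb_uniq (a b : I -> rat) :
  \sum_i a i *: c i = \sum_i b i *: c i -> a =1 b.
Proof.
move=> ab i; apply/eqP; rewrite -subr_eq0; apply/eqP.
apply: (free (a := fun i => a i - b i)).
under eq_bigr do rewrite scalerBl.
by rewrite sumrB ab subrr.
Qed.

Lemma comb_cap (D E : {set I}) T : comb D T -> comb E T -> comb (D :&: E) T.
Proof.
move=> [a [aD ->]] [b [bE /comb_uniq ab]]; exists a; split=> // i.
by rewrite finset.in_setI negb_and => /orP[/aD//|/bE]; rewrite ab.
Qed.

Lemma comb_c_inv (D : {set I}) i : comb D (c i) -> i \in D.
Proof.
move=> Dc; apply: contraT => iD.
have [a [aD aE]] := comb_cap (comb_c (finset.set11 i)) Dc.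
have c0 : \sum_j (j == i)%:R *: c j = 0 :> H.
  rewrite (bigD1 i)//= eqxx scale1r big1 ?addr0 => [|j /negPf ->]; last exact: scale0r.
  rewrite aE big1// => j _; rewrite aD ?scale0r// !inE.
  by apply/negP => /andP[/eqP ->]; rewrite (negPf iD).
by have := free c0 i; rewrite eqxx.
Qed.

(** A down-closed set of indices spans an ideal. *)
Lemma comb_mul D S T : down_closed D -> comb D S -> comb D (S * T).
Proof.
move=> dD [a [aD ->]]; rewrite mulr_suml; apply: comb_sum => i _.
rewrite -hecke_scaleAl; have [iD|iD] := boolP (i \in D); last first.
  by rewrite aD// scale0r; exact: comb0.
apply: combZ; have [b bE] := coords (c i * T); exists b; split=> // j jD.
apply: (cmul bE); apply: contra jD; exact: dD.
Qed.

Lemma comb_mulr D S T : down_closed D -> comb D T -> comb D (S * T).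
Proof. by rewrite mulC; exact: comb_mul. Qed.

Lemma comb_split (D : {set I}) i T : comb D T ->
  exists x S, comb (D :\ i) S /\ T = x *: c i + S.
Proof.
move=> [a [aD ->]]; exists (a i), (\sum_(j | j != i) a j *: c j).
split; last by rewrite (bigD1 i).
apply: comb_sum => j ji; have [jD|jD] := boolP (j \in D).
  by apply: combZ; apply: comb_c; rewrite !inE ji.
by rewrite aD// scale0r; exact: comb0.
Qed.

(** The elements below [i], and strictly below [i]. *)
Definition down i := [set j | le j i].
Definition down_strict i := down i :\ i.

Lemma down_self i : i \in down i. Proof. by rewrite finset.in_set. Qed.

Lemma down_down_closed i : down_closed (down i).
Proof. by move=> j k; rewrite !finset.in_set => ki jk; exact: le_trans ki. Qed.

Lemma down_closedD1 (D : {set I}) i : down_closed D ->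
  (forall j, j \in D -> le i j -> j = i) -> down_closed (D :\ i).
Proof.
move=> dD imax j k; rewrite !finset.in_setD1 => /andP[ki kD] jk.
rewrite (dD j k)// andbT; apply: contra ki => /eqP ji.
by rewrite ji in jk; apply/eqP/imax.
Qed.

Lemma down_strict_closed i : down_closed (down_strict i).
Proof.
apply: down_closedD1; first exact: down_down_closed.
by move=> j; rewrite finset.in_set => ji ij; apply: le_anti; rewrite ji.
Qed.

Lemma down_sub (D : {set I}) i : down_closed D -> i \in D -> down i \subset D.
Proof. by move=> dD iD; apply/fintype.subsetP => j; rewrite finset.in_set; exact: dD. Qed.

Lemma down_strict_sub i : down_strict i \subset down i.
Proof. exact: subsetDl. Qed.

Lemma card_down i j : le j i -> j != i -> (#|down j| < #|down i|)%N.
Proof.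
move=> ji neq; apply: proper_card; apply/properP; split.
  by apply: down_sub; [exact: down_down_closed|rewrite finset.in_set].
exists i; first exact: down_self.
by rewrite finset.in_set; apply: contra neq => ij; apply/eqP/le_anti; rewrite ji.
Qed.

(** Every ideal spanned by a down-closed set of the [c i] has a unit: if [i] is
    maximal in [D] and [u] is the unit for [D :\ i], then [c i - u * c i] squares
    to a nonzero multiple of itself, and normalising it gives the missing
    idempotent. *)
Lemma unit_ex (D : {set I}) : down_closed D ->
  exists u, comb D u /\ forall T, comb D T -> u * T = T.
Proof.
have [n] := ubnP #|D|; elim: n D => // n IHn D; rewrite ltnS => Dn dD.
have [->|/set0Pn[i0 i0D]] := eqVneq D finset.set0.
  exists 0; split=> [|T [a [a0 ->]]]; first exact: comb0.
  by rewrite mul0r big1// => i _; rewrite a0 ?scale0r// inE.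
case: (arg_maxnP (fun i => #|down i|) i0D) => i; rewrite -[X in is_true X]/(i \in D) => iD imax.
have {imax}imax j : j \in D -> le i j -> j = i.
  move=> jD ij; apply/eqP; apply: contraT => ji.
  have := imax j jD; rewrite /= leqNgt card_down//.
  by rewrite eq_sym.
have dE := down_closedD1 dD imax.
have [|u [Eu u1]] := IHn (D :\ i) _ dE.
  by move: Dn; rewrite (cardsD1 i D) iD.
pose d := c i - u * c i.
have dE0 T : comb (D :\ i) T -> d * T = 0.
  by move=> ET; rewrite mulrBl (mulC u) -mulrA u1// subrr.
have ucE : comb (D :\ i) (u * c i) by exact: comb_mul.
have Dd : comb D d.
  apply: combB; first exact: comb_c.
  exact: comb_mono (subsetDl _ _) ucE.
have d0 : d != 0.
  apply/eqP => /eqP; rewrite subr_eq0 => /eqP cE.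
  by have := comb_c_inv (eq_ind_r (comb _) ucE cE); rewrite finset.in_setD1 eqxx.
have [x [S [ES cdE]]] := comb_split i (comb_mul (c i) dD Dd).
have dd : d * d = x *: d.
  rewrite {2}/d mulrBr (dE0 _ ucE) subr0.
  have : d * c i - u * (d * c i) = x *: d.
    by rewrite cdE mulrDr (u1 S)// opprD addrACA subrr addr0 -hecke_scaleAr -scalerBr.
  by rewrite mulrA (mulC u d) (dE0 _ Eu) mul0r subr0.
have x0 : x != 0.
  by apply: contra d0 => /eqP x0; apply/eqP/reduced; rewrite dd x0 scale0r.
exists (u + x^-1 *: d); split.
  apply: combD; last exact: combZ.
  exact: comb_mono (subsetDl _ _) Eu.
move=> T /(comb_split i)[y [T' [ET' ->]]].
have dc : x^-1 *: d * c i = d.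
  have -> : c i = d + u * c i by rewrite subrK.
  rewrite mulrDr -!hecke_scaleAl dd (dE0 _ ucE) scaler0 addr0.
  by rewrite scalerA mulVf// scale1r.
rewrite mulrDr -hecke_scaleAr; congr (_ *: _ + _).
  by rewrite mulrDl dc addrC subrK.
by rewrite mulrDl u1// -hecke_scaleAl (dE0 _ ET') scaler0 addr0.
Qed.

(** The primitive idempotents [e i], each the difference of the units of two
    ideals that differ by the index [i]; they determine every ideal spanned by a
    down-closed set of the [c i]. *)
Lemma idempotents_ex : exists e : I -> H,
  [/\ forall i, e i != 0,
      forall i j, e i * e j = if i == j then e i else 0,
      \sum_i e i = 1,
      forall i T, exists x, T * e i = x *: e i
    & forall D, down_closed D -> forall T,
        comb D T <-> forall i, i \notin D -> T * e i = 0].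
Proof.
have /choice[eps epsP] (D : {set I}) : exists u, down_closed D ->
    comb D u /\ forall T, comb D T -> u * T = T.
  have [/unit_ex[u uP]|nD] := pselect (down_closed D); first by exists u.
  by exists 0.
have eps_in D : down_closed D -> comb D (eps D) by move=> /epsP[].
have eps1 D T : down_closed D -> comb D T -> eps D * T = T by move=> /epsP[_]; exact.
have dnC := down_down_closed; have dsC := down_strict_closed.
have ds_dn i T : comb (down_strict i) T -> comb (down i) T.
  exact: comb_mono (down_strict_sub i).
pose e i := eps (down i) - eps (down_strict i).
have e_in i : comb (down i) (e i).
  by apply: combB; [exact: eps_in|apply: ds_dn; exact: eps_in].
have e_kill i T : comb (down_strict i) T -> e i * T = 0.
  move=> dT; rewrite mulrBl (eps1 (down_strict i))// (eps1 (down i)) ?subrr//.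
  exact: ds_dn.
have e_neq0 i : e i != 0.
  apply/eqP => /eqP; rewrite subr_eq0 => /eqP ee.
  have ci : comb (down_strict i) (c i).
    rewrite -(eps1 (down i) (c i))//; last exact/comb_c/down_self.
    by rewrite ee; apply: comb_mul (dsC i) _; exact: eps_in _ (dsC i).
  by have := comb_c_inv ci; rewrite finset.in_setD1 eqxx.
have e_idem i : e i * e i = e i.
  rewrite {2}/e mulrBr (e_kill i (eps (down_strict i))) ?subr0; last exact: eps_in.
  by rewrite mulC eps1.
have e_eigen i T : exists x, T * e i = x *: e i.
  (* Modulo the strict ideal of [i], which [e i] kills, everything in the ideal
   of [i] is a multiple of [c i]. *)
  have key S : exists x, S * e i = x *: (c i * e i).
    have [x [S' [dS' SE]]] := comb_split i (comb_mulr S (dnC i) (e_in i)).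
    exists x; rewrite -[e i in LHS]e_idem mulrA SE mulrDl (mulC S') e_kill// addr0.
    by rewrite hecke_scaleAl.
  have [x xE] := key T; have [y yE] := key 1; rewrite mul1r in yE.
  have y0 : y != 0.
    by apply: contra (e_neq0 i) => /eqP y0; rewrite yE y0 scale0r.
  by exists (x / y); rewrite xE [in RHS]yE scalerA divfK.
have e_comb D i : comb D (e i) -> i \in D.
  move=> De; apply: contraT => iD.
  have : comb (down_strict i) (e i).
    apply: comb_mono (comb_cap De (e_in i)); apply/fintype.subsetP => j.
    rewrite finset.in_setI finset.in_setD1 => /andP[jD ->]; rewrite andbT.
    by apply: contra iD => /eqP <-.
  by move=> /(e_kill i); rewrite e_idem => /eqP; rewrite (negPf (e_neq0 i)).
have e_orth i j : e i * e j = if i == j then e i else 0.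
  case: eqP => [<-//|neq]; apply/eqP; apply: contraT => nz; case: neq.
  have sub k l : e k * e l != 0 -> le k l.
    have [x xE] := e_eigen k (e l); rewrite mulC xE => xe.
    have x0 : x != 0 by apply: contra xe => /eqP ->; rewrite scale0r.
    have : comb (down l) (e k).
      rewrite -[e k]scale1r -(mulVf x0) -scalerA -xE; apply: combZ.
      exact: comb_mul.
    by move=> /e_comb; rewrite finset.in_set.
  by apply: le_anti; rewrite !sub// mulC.
(* By induction along the poset, an element killing every [e i] kills the unit of
   each ideal, hence every [c i]. *)
have e_total T : (forall i, T * e i = 0) -> T = 0.
  move=> Te; suff Tc i : T * c i = 0.
    have [a aE] := coords 1; rewrite -[T]mulr1 aE mulr_sumr big1// => i _.
    by rewrite -hecke_scaleAr Tc scaler0.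
  have [n] := ubnP #|down i|; elim: n i => // n IHn i; rewrite ltnS => cn.
  rewrite -(eps1 (down i) (c i))//; last exact/comb_c/down_self.
  have -> : eps (down i) = e i + eps (down_strict i) by rewrite subrK.
  rewrite mulrA mulrDr Te add0r.
  have [a [a0 ->]] := eps_in _ (dsC i); rewrite mulr_sumr big1 ?mul0r// => j _.
  rewrite -hecke_scaleAr; have [|jd] := boolP (j \in down_strict i); last first.
    by rewrite a0// scale0r.
  rewrite finset.in_setD1 finset.in_set => /andP[neq ji].
  by rewrite IHn ?scaler0//; exact: leq_trans (card_down ji neq) cn.
have e_sum : \sum_i e i = 1.
  apply/esym/eqP; rewrite -subr_eq0; apply/eqP/e_total => i.
  rewrite mulrBl mul1r mulr_suml (bigD1 i)//= e_idem big1 ?addr0 ?subrr// => j ji.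
  by rewrite e_orth (negPf ji).
exists e; split=> // D dD T; split=> [DT i iD|Te].
  have [x xE] := e_eigen i T; have [x0|x0] := eqVneq x 0.
    by rewrite xE x0 scale0r.
  suff : i \in D by rewrite (negPf iD).
  apply: e_comb; rewrite -[e i]scale1r -(mulVf x0) -scalerA -xE.
  by apply: combZ; exact: comb_mul.
rewrite -[T]mulr1 -e_sum mulr_sumr; apply: comb_sum => i _.
have [iD|iD] := boolP (i \in D); last by rewrite Te//; exact: comb0.
apply: comb_mono (down_sub dD iD) _; exact: comb_mulr.
Qed.

End Idempotents.

Section HeckeIdempotents.
Variables (R : pzRingType) (Phi phi : mtype R) (F : lmodType R).
Hypothesis couple : symmetric_couple Phi phi.
Hypothesis F_type : has_type Phi F.
Hypothesis finF : finite_set [set: submodule F].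
Local Notation H := (hecke F phi).

(** The span of the [c_mu] with [Q mu]. *)
Definition hecke_span (Q : mtype R -> Prop) : submodule H :=
  span (fun T => exists2 mu, Q mu & T = cellop finF phi mu).

(** Membership in the span, in terms of an enumeration [t] of the types. *)
Lemma hecke_spanP (I : finType) (t : I -> mtype R) (Q : mtype R -> Prop) (T : H) :
  (forall mu, Q mu -> exists i, t i = mu) ->
  T \in hecke_span Q <->
  comb (fun i => cellop finF phi (t i)) [set i | `[< Q (t i) >]] T.
Proof.
move=> Qt; split=> [/in_span[n [a [s [sQ ->]]]]|[a [aQ ->]]].
  apply: comb_sum => k _; apply: combZ; have [mu Qmu ->] := sQ k.
  have [i ti] := Qt mu Qmu; rewrite -ti.
  by apply: (comb_c (fun i => cellop finF phi (t i))); rewrite finset.in_set ti; apply/asboolP.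
apply: rpred_sum => i _; have [iQ|iQ] := boolP (i \in [set i | `[< Q (t i) >]]).
  apply: rpredZ; apply: span_subset; exists (t i) => //.
  by rewrite finset.in_set in iQ; apply/asboolP.
by rewrite aQ// scale0r rpred0.
Qed.

(** The idempotents of the Hecke algebra, indexed by the types below [phi], and
    the membership criteria for the two filtrations. *)
Lemma hecke_idempotents : exists (I : finType) (t : I -> mtype R) (e : I -> H),
  [/\ [/\ injective t, forall i, mtype_le (t i) phi
        & forall lam, mtype_le lam phi -> exists i, t i = lam],
      [/\ forall i, e i != 0,
          forall i j, e i * e j = if i == j then e i else 0,
          \sum_i e i = 1
        & forall i T, exists x, T * e i = x *: e i],
      forall lam, mtype_le lam phi -> forall T, T \in hecke_le finF phi lam <->
        forall i, ~ mtype_le (t i) lam -> T * e i = 0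
    & forall lam, mtype_le lam phi -> forall T, T \in hecke_lt finF phi lam <->
        forall i, ~ mtype_lt (t i) lam -> T * e i = 0].
Proof.
have [I [t [t_inj t_le t_surj]]] := mtype_enum couple F_type finF.
pose le i j := `[< mtype_le (t i) (t j) >].
have le_refl : reflexive le by move=> i; apply/asboolP/mtype_le_refl.
have le_anti : antisymmetric le.
  move=> i j /andP[/asboolP ij /asboolP ji]; apply: t_inj.
  exact: (mtype_le_anti couple F_type finF (t_le j)).
have le_trans : transitive le.
  by move=> i j k /asboolP ji /asboolP ik; apply/asboolP; exact: mtype_le_trans ik.
pose c i := cellop finF phi (t i).
have [|e [e0 ee e1 ex eD]] := idempotents_ex (c := c) le_refl le_anti le_trans
  (hecke_mulC couple F_type finF) (@hecke_reduced _ _ _ _ couple F_type finF)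
  (cellop_coords couple F_type finF t_inj t_le t_surj)
  (@cellop_free _ _ _ _ couple F_type finF _ _ t_inj t_le).
  move=> i T a /(cellop_mul couple F_type t_inj t_le) aE j /asboolP; exact: aE.
have in_setNP (Q : I -> Prop) T :
    (forall i, i \notin [set i | `[< Q i >]] -> T * e i = 0) <->
    (forall i, ~ Q i -> T * e i = 0).
  split=> Te i iQ; apply: Te; first by rewrite finset.in_set; apply/asboolP.
  by move: iQ; rewrite finset.in_set => /asboolP.
exists I, t, e; split=> //.
- move=> lam lamP T; rewrite -[hecke_le _ _ _]/(hecke_span (fun mu => mtype_le mu lam)).
  rewrite (hecke_spanP (t := t)); last by move=> mu ml; apply: t_surj; exact: mtype_le_trans lamP.
  rewrite eD; last first.
    move=> i j; rewrite !finset.in_set => /asboolP jl /asboolP ij; apply/asboolP.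
    exact: mtype_le_trans jl.
  exact: in_setNP.
- move=> lam lamP T; rewrite -[hecke_lt _ _ _]/(hecke_span (fun mu => mtype_lt mu lam)).
  rewrite (hecke_spanP (t := t)); last by move=> mu [ml _]; apply: t_surj; exact: mtype_le_trans lamP.
  rewrite eD; last first.
    move=> i j; rewrite !finset.in_set => /asboolP[jl neq] /asboolP ij; apply/asboolP.
    split; first exact: mtype_le_trans jl.
    by move=> il; apply: neq; apply: (mtype_le_anti couple F_type finF lamP) => //; rewrite -il.
  exact: in_setNP.
Qed.

End HeckeIdempotents.

(** * Simple modules *)

Section QuotientProjection.
Local Open Scope quotient_scope.
Variables (R : pzRingType) (M : lmodType R) (x : submodule M).

(** The canonical projection onto the quotient module. *)
Definition quotmod_proj (v : M) : quotmod x :=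
  \pi_(Quotient.quot (submod_pred x)) v.

Fact quotmod_proj_linear : linear quotmod_proj.
Proof.
move=> a u v; rewrite /quotmod_proj raddfD; congr (_ + _).
exact/esym/quotmod_scale_pi.
Qed.
HB.instance Definition _ :=
  GRing.isLinear.Build R M (quotmod x) _ quotmod_proj quotmod_proj_linear.

Lemma quotmod_proj_eq0 v : quotmod_proj v = 0 <-> v \in x.
Proof.
rewrite -{2}[v]subr0 Quotient.idealrBE; split=> [v0|/eqP v0].
  apply/eqP; rewrite -[LHS]/(quotmod_proj v) v0; exact/esym/raddf0.
by rewrite /quotmod_proj v0; exact: raddf0.
Qed.

Lemma quotmod_proj_surj (q : quotmod x) : exists v, quotmod_proj v = q.
Proof. by exists (repr q); rewrite /quotmod_proj reprK. Qed.

End QuotientProjection.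

Lemma inj_surj_bij (T U : Type) (f : T -> U) :
  injective f -> (forall y, exists x, f x = y) -> bijective f.
Proof.
move=> fI fS; pose g y := projT1 (cid (fS y)).
have fg : cancel g f by move=> y; exact: projT2 (cid (fS y)).
by exists g => // x; apply: fI; rewrite fg.
Qed.

Section Lines.
Variables (R : pzRingType) (F : lmodType R) (phi : mtype R).
Local Notation H := (hecke F phi).
Variables (I : finType) (e : I -> H).
Hypothesis mulC : forall S T : H, S * T = T * S.
Hypothesis e_orth : forall i j, e i * e j = if i == j then e i else 0.
Hypothesis e_sum : \sum_i e i = 1.
Hypothesis e_eigen : forall i T, exists x, T * e i = x *: e i.
Implicit Types (M N : lmodType H).

(* The rational scalar [x] as an element of the algebra. *)
Local Notation sc x := (hecke_scale x (hecke_one F phi)).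

Lemma hecke_scalarM x (T : H) : sc x * T = x *: T.
Proof. exact: heckeP. Qed.

Lemma hecke_scalarV x : x != 0 -> sc x^-1 * sc x = 1.
Proof.
move=> x0; rewrite hecke_scalarM -[sc x]/(x *: (1 : hecke F phi)) scalerA mulVf//.
exact: scale1r.
Qed.

(** [v] generates [M] and is fixed by [e i]; such a module is the simple module
    on which the Hecke algebra acts through the block of [e i]. *)
Definition line i M (v : M) :=
  [/\ v <> 0, e i *: v = v & forall m, exists a : H, m = a *: v].

(** Every element of the algebra acts on the generator of a line by a
    rational scalar. *)
Lemma line_eigen i M (v : M) (a : H) : line i v -> exists x : rat,
  [/\ a * e i = x *: e i, a *: v = sc x *: v & (x = 0 -> a *: v = 0)].
Proof.
move=> [_ ev _]; have [x ax] := e_eigen i a.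
have av : a *: v = sc x *: v.
  by rewrite -[in LHS]ev scalerA ax -hecke_scalarM -scalerA ev.
exists x; split=> // x0; rewrite -ev scalerA ax x0.
by rewrite !scale0r.
Qed.

(** The annihilator of [v] depends on [i] only, so lines of the same index are
    isomorphic. *)
Lemma line_ann i M (v : M) (a : H) : line i v -> a *: v = 0 <-> a * e i = 0.
Proof.
move=> lv; have [v0 ev _] := lv; split=> [|ae]; last first.
  by rewrite -ev scalerA ae scale0r.
have [x [ax av _]] := line_eigen a lv; have [x0|x0] := eqVneq x 0.
  by rewrite ax x0 scale0r.
move=> av0; case: v0; rewrite -[v]scale1r -(hecke_scalarV x0).
by rewrite -scalerA -av av0 scaler0.
Qed.

Lemma line_iso i M N (v : M) (w : N) : line i v -> line i w -> isomorphic M N.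
Proof.
move=> lv lw; have [_ _ gv] := lv; have [_ _ gw] := lw.
(* [a *: v] is sent to [a *: w]; [line_ann] makes this well defined. *)
pose f (m : M) : N := projT1 (cid (gv m)) *: w.
have fE a : f (a *: v) = a *: w.
  rewrite /f; case: cid => b /= ab; apply/eqP; rewrite -subr_eq0 -scalerBl; apply/eqP.
  by apply/(line_ann _ lw)/(line_ann _ lv); rewrite scalerBl -ab subrr.
have fl : linear f.
  move=> a m m'; have [b ->] := gv m; have [b' ->] := gv m'.
  by rewrite scalerA -scalerDl !fE scalerDl scalerA.
exists (mk_linear fl); apply: inj_surj_bij => [m m'|n].
  have [b ->] := gv m; have [b' ->] := gv m' => /=; rewrite !fE => /eqP.
  rewrite -subr_eq0 -scalerBl => /eqP/(line_ann _ lw)/(line_ann _ lv)/eqP.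
  by rewrite scalerBl subr_eq0 => /eqP.
by have [b ->] := gw n; exists (b *: v); exact: fE.
Qed.

Lemma line_irreducible i M (v : M) : line i v -> irreducible M.
Proof.
move=> lv; have [v0 ev gv] := lv; split; first by exists v; apply/eqP.
move=> x; have [[m mx m0]|nx] := pselect (exists2 m, m \in x & m != 0); [right|left].
  move=> w; have [b ->] := gv w; apply: rpredZ.
  have [a ma] := gv m; have [y [ay av y0]] := line_eigen a lv.
  have {y0}y0 : y != 0 by apply: contra m0 => /eqP/y0; rewrite -ma => ->.
  have -> : v = sc y^-1 *: m by rewrite ma av scalerA hecke_scalarV// scale1r.
  exact: rpredZ.
by move=> v' v'x; apply/eqP; apply: contraT => v'0; case: nx; exists v'.
Qed.

Lemma line_iso_eq i j M N (v : M) (w : N) :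
  line i v -> line j w -> isomorphic M N -> i = j.
Proof.
move=> lv lw [f bf]; have [v0 ev _] := lv; have [_ ew gw] := lw.
apply/eqP; apply: contraT => ij; case: v0; apply: (bij_inj bf).
have [a fv] := gw (f v).
rewrite linear0 -ev linearZ_LR/= fv scalerA mulC -scalerA -ew !scalerA.
by rewrite -mulrA e_orth (negPf ij) mulr0 scale0r.
Qed.

Lemma irreducible_line M : irreducible M -> exists i (v : M), line i v.
Proof.
move=> [[v v0] irr].
have [i ev] : exists i, e i *: v != 0.
  apply: contrapT => /forallNP ev; move/eqP: v0; apply.
  rewrite -[v]scale1r -e_sum scaler_suml big1// => i _; apply/eqP.
  by apply: contraT => /(ev i).
exists i, (e i *: v); split; first exact/eqP.
  by rewrite scalerA e_orth eqxx.
have cl : GRing.submod_closed [pred m | `[< exists a : H, m = a *: (e i *: v) >]].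
  split=> [|b m m']; first by apply/asboolP; exists 0; rewrite scale0r.
  move=> /asboolP[a ->] /asboolP[a' ->]; apply/asboolP; exists (b * a + a').
  by rewrite scalerDl -[in RHS]scalerA.
have [z|a] := irr (Submodule cl); last by move=> m; have /asboolP := a m.
case/eqP: ev; apply: z; apply/asboolP; exists 1; by rewrite scale1r.
Qed.

(** A submodule of the algebra cut out by a set [D] of idempotents is the direct
    sum of the corresponding simple modules. *)
Lemma dsum_lines (x : submodule H^o) n (r : 'I_n -> I) (K : 'I_n -> lmodType H)
    (v : forall k, K k) :
  injective r -> (forall k, line (r k) (v k)) ->
  (forall T : H, T \in x <-> forall i, (forall k, r k != i) -> T * e i = 0) ->
  isomorphic (subm x) (dsum K).
Proof.
move=> rI lv xP.
(* [T] is sent to the family of the [T *: v k]. *)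
pose f (T : subm x) : dsum K := fun k => (val T : H) *: v k.
have fl : linear f.
  move=> a S T; apply: functional_extensionality_dep => k.
  have vE : val (a *: S + T) = a *: (val S : H^o) + val T by [].
  rewrite /f vE -[RHS]/(a *: ((val S : H) *: v k) + (val T : H) *: v k).
  by rewrite scalerA -scalerDl.
exists (mk_linear fl); apply: inj_surj_bij => [S T fST|m].
  have ST i : (val S - val T : H) * e i = 0.
    have [[k <-]|nk] := pselect (exists k, r k = i).
      apply/(line_ann _ (lv k)); rewrite scalerBl; apply/eqP; rewrite subr_eq0.
      by apply/eqP; exact: (congr1 (fun g : dsum K => g k) fST).
    have : (val S - val T : H^o) \in x by rewrite rpredB// subm_mem.
    by move/xP; apply => k; apply/eqP => ki; apply: nk; exists k.
  apply: val_inj; apply/eqP; rewrite -subr_eq0; apply/eqP.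
  rewrite -[LHS](mulr1 (_ : H)) -e_sum mulr_sumr big1// => i _; exact: ST.
have g k : exists a : H, m k = a *: v k by have [_ _] := lv k; apply.
pose a k := projT1 (cid (g k)).
have aP k : m k = a k *: v k := projT2 (cid (g k)).
have Tx : (\sum_k a k * e (r k) : H) \in submod_pred x.
  apply/xP => i nr; rewrite mulr_suml big1// => k _.
  by rewrite -mulrA e_orth (negPf (nr k)) mulr0.
exists (exist (fun v => v \in submod_pred x) _ Tx).
apply: functional_extensionality_dep => k; rewrite aP /= /f /=.
have [_ ev _] := lv k; rewrite scaler_suml (bigD1 k)//= -scalerA ev big1 ?addr0// => j jk.
rewrite -ev scalerA -mulrA e_orth (inj_eq rI) (negPf jk).
by rewrite mulr0 scale0r.
Qed.

End Lines.

(** * Structure of the Hecke algebra *)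

Theorem theorem4 (R : pzRingType) (Phi phi : mtype R) (F : lmodType R)
  (couple : symmetric_couple Phi phi)
  (F_type : has_type Phi F)
  (finF : finite_set [set: submodule F]) :
  exists (Ile : forall lam, mtype_le lam phi -> is_ideal (hecke_le finF phi lam))
         (Ilt : forall lam, mtype_le lam phi -> is_ideal (hecke_lt finF phi lam)),
  let H lam (l : mtype_le lam phi) := ideal_mod (Ile lam l) in
  let K lam (l : mtype_le lam phi) := ideal_quot (Ile lam l) (Ilt lam l) in
  [/\ forall lam, mtype_le lam phi ->
        has_unit (hecke_le finF phi lam) /\ has_unit (hecke_lt finF phi lam),
      forall lam mu, mtype_le lam phi -> mtype_le mu phi ->
        ideal_mul (hecke_le finF phi lam) (hecke_le finF phi mu) =i
          [predI hecke_le finF phi lam & hecke_le finF phi mu] /\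
        (mtypes_lattice R -> forall nu, is_meet lam mu nu ->
          [predI hecke_le finF phi lam & hecke_le finF phi mu] =i
            hecke_le finF phi nu),
      [/\ forall lam (l : mtype_le lam phi), irreducible (K lam l),
          forall lam (l : mtype_le lam phi) mu (m : mtype_le mu phi),
            isomorphic (K lam l) (K mu m) -> lam = mu
        & forall M : lmodType (hecke F phi), irreducible M ->
            exists lam (l : mtype_le lam phi), isomorphic M (K lam l)]
    & forall lam (l : mtype_le lam phi),
        exists (n : nat) (t : 'I_n -> mtype R)
               (tphi : forall i, mtype_le (t i) phi),
          [/\ injective t,
              forall mu, mtype_le mu lam <-> exists i, t i = mu
            & isomorphic (H lam l) (dsum (fun i => K (t i) (tphi i)))]].
Proof.
have [I [t [e [[t_inj t_le t_surj] [e0 ee e1 ex] leP ltP]]]] :=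
  hecke_idempotents couple F_type finF.
have mulC := hecke_mulC couple F_type finF.
(* Each filtration step is cut out by the vanishing of [T * e i] for the indices
   outside a set [Q], which makes it an ideal with unit the sum of the [e i] for
   [i] in [Q]. *)
have ideal_of (x : submodule (hecke F phi)) (Q : I -> Prop) :
    (forall T, T \in x <-> forall i, ~ Q i -> T * e i = 0) -> is_ideal x.
  move=> xP; split; first by split=> [|S T]; [exact: rpred0|exact: rpredB].
  move=> S T /xP Te; split; apply/xP => i /Te Tei.
    by rewrite -mulrA Tei mulr0.
  by rewrite (mulC T) -mulrA Tei mulr0.
have unit_of (x : submodule (hecke F phi)) (Q : I -> Prop) :
    (forall T, T \in x <-> forall i, ~ Q i -> T * e i = 0) -> has_unit x.
  move=> xP; exists (\sum_(i | `[< Q i >]) e i).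
    apply/xP => i nQ; rewrite mulr_suml big1// => j /asboolP Qj.
    by rewrite ee; case: eqP => // ji; rewrite ji in Qj.
  move=> T /xP Te.
  have T1 : T * \sum_(i | `[< Q i >]) e i = T.
    rewrite -[RHS]mulr1 -e1 !mulr_sumr [RHS](bigID (fun i => `[< Q i >]))/=.
    by rewrite [X in _ + X]big1 ?addr0// => i /asboolP; exact: Te.
  by rewrite mulC T1.
pose Ile lam (l : mtype_le lam phi) := ideal_of _ _ (leP lam l).
pose Ilt lam (l : mtype_le lam phi) := ideal_of _ _ (ltP lam l).
exists Ile, Ilt => H K.
have e_le i lam (l : mtype_le lam phi) : mtype_le (t i) lam -> e i \in hecke_le finF phi lam.
  move=> il; apply/(leP _ l) => j nj; rewrite ee; case: eqP => // ij.
  by rewrite -ij in nj.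
(* [K_lam] is generated by the class of the idempotent of index [lam]. *)
have K_line i lam (l : mtype_le lam phi) : t i = lam -> exists v : K lam l, line e i v.
  move=> til.
  have eP : (e i : (hecke F phi)^o) \in submod_pred (left_ideal (Ile lam l)).
    by apply: e_le; rewrite // til; exact: mtype_le_refl.
  pose eI : H lam l := exist (fun v => v \in submod_pred (left_ideal (Ile lam l))) _ eP.
  pose p := @quotmod_proj _ (H lam l) (submod_preim
    (val : {linear subm (left_ideal (Ile lam l)) -> (hecke F phi)^o})
    (left_ideal (Ilt lam l))).
  have p0 T : p T = 0 <-> forall j, ~ mtype_lt (t j) lam -> (val T : hecke F phi) * e j = 0.
    by rewrite -(ltP lam l); exact: quotmod_proj_eq0.
  have p_eq S T : (forall j, ~ mtype_lt (t j) lam ->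
      (val S : hecke F phi) * e j = (val T : hecke F phi) * e j) -> p S = p T.
    move=> ST; apply/eqP; rewrite -subr_eq0 -[_ - _](raddfB p); apply/eqP/p0 => j /ST Sj.
    by rewrite mulrBl Sj subrr.
  exists (p eI); split.
  - move/p0 => /(_ i); rewrite ee eqxx => eI0; case/eqP: (e0 i); apply: eI0.
    by case=> _; rewrite til.
  - rewrite -[LHS](linearZ_LR p); apply: p_eq => j _ /=.
    by rewrite -[_ *: _]/(e i * e i) ee eqxx.
  - move=> q; have [T <-] := quotmod_proj_surj q; exists (val T : hecke F phi).
    rewrite -[RHS](linearZ_LR p); apply: p_eq => j nj /=.
    rewrite -[_ *: _]/((val T : hecke F phi) * e i) -mulrA ee; case: eqP => [->//|ij].
    rewrite mulr0; have /(leP lam l) := valP T; apply => jl; apply: nj; split=> //.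
    by rewrite -til => /t_inj ji; rewrite ji in ij.
split.
- by move=> lam l; split; [apply: unit_of (leP lam l)|apply: unit_of (ltP lam l)].
- move=> lam mu l m; split=> [T|_ nu [nl nm nuP] T]; last first.
    have nuphi := mtype_le_trans nl l.
    apply/andP/idP => [[/(leP lam l) Tl /(leP mu m) Tm]|/(leP nu nuphi) Tn].
      apply/(leP nu nuphi) => i ni.
      have [il|] := pselect (mtype_le (t i) lam); last exact: Tl.
      by apply: Tm => im; apply: ni; exact: nuP.
    split; [apply/(leP lam l)|apply/(leP mu m)] => i ni; apply: Tn => iN; apply: ni.
      exact: mtype_le_trans nl.
    exact: mtype_le_trans nm.
  apply/asboolP/andP => [[n [u [v [uv ->]]]]|[Tl Tm]].
    split; apply: rpred_sum => k _; have [uk vk] := uv k.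
      by have [_ /(_ (v k) _ uk)[]] := Ile lam l.
    by have [_ /(_ (u k) _ vk)[]] := Ile mu m.
  (* An element of the intersection is its own product with a unit. *)
  have [u um uP] := unit_of _ _ (leP mu m).
  exists 1%N, (fun=> T), (fun=> u); split=> //.
  by rewrite big_ord1; have [] := uP T Tm.
- split.
  + move=> lam l; have [i ti] := t_surj lam l; have [v lv] := K_line i lam l ti.
    exact: line_irreducible lv.
  + move=> lam l mu m; have [i ti] := t_surj lam l; have [j tj] := t_surj mu m.
    have [v lv] := K_line i lam l ti; have [w lw] := K_line j mu m tj.
    by move=> /(line_iso_eq mulC ee lv lw) ij; rewrite -ti ij.
  + move=> M /(irreducible_line ee e1)[i [v lv]]; exists (t i), (t_le i).
    have [w lw] := K_line i (t i) (t_le i) erefl.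
    exact: line_iso lv lw.
- move=> lam l; pose J := [set i | `[< mtype_le (t i) lam >]].
  exists #|J|, (fun k => t (enum_val k)), (fun k => t_le (enum_val k)); split.
  + by move=> k k' /t_inj/enum_val_inj.
  + move=> mu; split=> [ml|[k <-]]; last first.
      by have := enum_valP k; rewrite finset.in_set => /asboolP.
    have [i ti] := t_surj mu (mtype_le_trans ml l).
    have iJ : i \in J by rewrite finset.in_set ti; apply/asboolP.
    by exists (enum_rank_in iJ i); rewrite enum_rankK_in.
  + have kv (k : 'I_#|J|) :=
      cid (K_line (enum_val k) (t (enum_val k)) (t_le (enum_val k)) erefl).
    apply: (dsum_lines ee e1 ex (r := fun k : 'I_#|J| => enum_val k)
      (v := fun k => projT1 (kv k))) => [||T].
    * exact: enum_val_inj.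
    * by move=> k; exact: projT2 (kv k).
    rewrite -[T \in _]/(T \in hecke_le finF phi lam) (leP lam l).
    split=> Te i ni; apply: Te.
      move=> il; have iJ : i \in J by rewrite finset.in_set; apply/asboolP.
      by have := ni (enum_rank_in iJ i); rewrite enum_rankK_in// eqxx.
    move=> k; apply/eqP => ki; apply: ni; rewrite -ki.
    by have := enum_valP k; rewrite finset.in_set => /asboolP.
Qed.
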